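(* There is a proper Zariski closed subset $B\subsetneq\mathbb{R}^5$ such that for every $(m_1,\dots,m_5)\in\mathbb{R}^5\setminus B$ the number of cross central configurations of the Newtonian six-body problem with masses $m_1,m_2,m_3,m_4,m_5,m_6$, where $m_6=m_5$, counted modulo translations, rotations and dilations of the plane, is finite.
   Context: Let $x=(x_1,\dots,x_6)\in(\mathbb{R}^2)^6$ with $x_i\neq x_j$ for $i\ne j$, put $r_{ij}=\|x_i-x_j\|$, let $m_1,\dots,m_6$ be real masses with $M=m_1+\cdots+m_6\neq0$, and let $c=\frac1M(m_1x_1+\cdots+m_6x_6)$. The configuration $x$ is called central if there is $\lambda\neq 0$ with $\sum_{j\neq i}m_j(x_j-x_i)r_{ij}^{-3}+\lambda(x_i-c)=0$ for $i=1,\dots,6$. A cross central configuration of the six-body problem (CC6BP) is a planar (non-collinear) central configuration of six bodies such that the set $\{x_1,\dots,x_6\}$ is symmetric with respect to a line $s$ containing exactly four of the six points. The bodies are indexed so that $x_1,x_2,x_3,x_4\in s$; then $x_5,x_6$ are mirror images of each other in $s$. (For such a configuration one always has $m_5=m_6$, so the masses are given by a point $(m_1,\dots,m_5)\in\mathbb{R}^5$.) Central configurations are invariant under translations, rotations and dilations, and they are counted modulo these transformations. A Zariski closed subset of $\mathbb{R}^5$ is the common zero set of a family of real polynomials in five variables. *)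

(* Defs.v *)
From HB Require Import structures.
From mathcomp Require Import all_boot all_order all_algebra.
From mathcomp Require Import mpoly.
From mathcomp Require Import boolp classical_sets cardinality reals.
Set Implicit Arguments. Unset Strict Implicit. Unset Printing Implicit Defensive.
Import Order.TTheory GRing.Theory Num.Theory.
Local Open Scope classical_set_scope.
Local Open Scope ring_scope.

Section CrossCentralConfigurations.
Variable R : realType.

Definition point := 'rV[R]_2.
Definition config := 'I_6 -> point.

(* The library's norm on row vectors is the sup norm, hence this one. *)
Definition dotp (u v : point) : R := \sum_(k < 2) u 0 k * v 0 k.
Definition enorm (u : point) : R := Num.sqrt (dotp u u).
Definition dist (x : config) (i j : 'I_6) : R := enorm (x i - x j).

Definition total_mass (m : 'I_6 -> R) : R := \sum_i m i.
Definition mass_center (m : 'I_6 -> R) (x : config) : point :=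
  (total_mass m)^-1 *: \sum_i m i *: x i.

Definition central (m : 'I_6 -> R) (x : config) : Prop :=
  [/\ total_mass m != 0, injective x &
   exists2 lam : R, lam != 0 &
     forall i : 'I_6,
       \sum_(j < 6 | j != i) (m j * dist x i j ^- 3) *: (x j - x i)
         + lam *: (x i - mass_center m x) = 0].

Definition line (p u : point) : set point := [set y | exists t : R, y = p + t *: u].

(* Orthogonal reflection in [line p u], for [u != 0]. *)
Definition reflection (p u y : point) : point :=
  p + (2 * dotp (y - p) u / dotp u u) *: u - (y - p).

Definition collinear (x : config) : Prop :=
  exists p u : point, u != 0 /\ forall i, line p u (x i).

(* Indices start at 0: the bodies on the axis are 0, 1, 2, 3, and the symmetry
   of the set of positions forces 4 and 5 to be mirror images. *)
Definition cross (x : config) : Prop :=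
  exists p u : point,
    [/\ u != 0,
        reflection p u @` range x = range x &
        forall i : 'I_6, line p u (x i) <-> (i < 4)%N].

Definition cross_central (m : 'I_6 -> R) : set config :=
  [set x | [/\ central m x, ~ collinear x & cross x]].

Definition rotation (A : 'M[R]_2) : Prop := A *m A^T = 1%:M /\ \det A = 1.

Definition similar (x y : config) : Prop :=
  exists (k : R) (A : 'M[R]_2) (t : point),
    [/\ 0 < k, rotation A & forall i, y i = k *: (x i *m A) + t].

Definition similarity_class (x : config) : set config := [set y | similar x y].

(* (m_1, ..., m_5) extended by m_6 = m_5; indices start at 0. *)
Definition masses6 (m : 'I_5 -> R) : 'I_6 -> R := fun i => m (inord (minn i 4)).

Definition zariski_closed (n : nat) (B : set ('I_n -> R)) : Prop :=
  exists F : set {mpoly R[n]}, B = [set v | forall p, F p -> p.@[v] = 0].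

End CrossCentralConfigurations.

(* Main.v *)
Require Import Defs.
From mathcomp Require Import all_boot all_order all_algebra.
From mathcomp Require Import mpoly.
From mathcomp Require Import boolp classical_sets cardinality reals.
From mathcomp Require Import ring lra zify.
From Stdlib Require List.
Import Order.TTheory GRing.Theory Num.Theory.
Local Open Scope classical_set_scope.
Local Open Scope ring_scope.
Set Implicit Arguments.
Unset Strict Implicit.
Unset Printing Implicit Defensive.

(** Put the two symmetric bodies at (0, 1) and (0, -1) and the others at (a_i, 0).
    Eliminating the multiplier leaves four equations linear in the five masses:
    [sum_k m_k K_ik + m_5 B_i = 0], where
    [K_ik = (|a_i - a_k|^-3 - rho (a_k)) (a_k - a_i)], [rho x = (1 + x^2)^(-3/2)]
    and [B_i = - 2 (rho (a_i) - 1/8) a_i].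

    The set of all solutions (m, a) has dimension at most 5: it is a finite union of
    strata on each of which five of the nine coordinates generate the others
    algebraically.  Some pair always has [K_ij K_ji <> 0]; according to which larger
    minors vanish one solves for 4, 3 or 2 masses, and the vanishing of the next
    minor is an algebraic equation for each missing abscissa.  It is a nontrivial
    one because it reads [p0 + rho p1 = 0] with [p1 <> 0], and (1 + x^2)^3 is not
    a square.

    Comparing the number of monomials with dimensions then yields a nonzero
    polynomial Q with Q(m, a_i) = 0 on all solutions.  If Q(., tau) is not the zero
    polynomial, it defines B: elsewhere each a_i is a root of the nonzero
    polynomial Q(m, .). *)


(** * Algebraic towers of functions *)

Section AlgebraicTowers.
Variables (F : fieldType) (T : Type).
Implicit Types (zs : list (T -> F)) (f g : T -> F) (P Q : T -> {poly F}) (W : set T).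

(** Polynomial expressions of degree at most [n] in the functions of [zs], kept as functions on [T]:
    the generators may satisfy relations. *)
Inductive polyfun zs : nat -> (T -> F) -> Prop :=
| polyfunC c : polyfun zs 0 (fun=> c)
| polyfun_var z : List.In z zs -> polyfun zs 1 z
| polyfunD n f g : polyfun zs n f -> polyfun zs n g ->
    polyfun zs n (fun w => f w + g w)
| polyfunM n p f g : polyfun zs n f -> polyfun zs p g ->
    polyfun zs (n + p) (fun w => f w * g w)
| polyfunW n p f : (n <= p)%N -> polyfun zs n f -> polyfun zs p f.

Lemma polyfun_sum zs n (I : Type) (r : seq I) (f : I -> T -> F) :
  (forall i, polyfun zs n (f i)) -> polyfun zs n (fun w => \sum_(i <- r) f i w).
Proof.
move=> fP; elim: r => [|i r IH].
  under eq_fun do rewrite big_nil.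
  by apply: (@polyfunW _ 0) => //; exact: polyfunC.
by under eq_fun do rewrite big_cons; exact: polyfunD.
Qed.

Lemma polyfun_prod zs n (I : Type) (r : seq I) (f : I -> T -> F) :
  (forall i, polyfun zs n (f i)) ->
  polyfun zs (size r * n) (fun w => \prod_(i <- r) f i w).
Proof.
move=> fP; elim: r => [|i r IH].
  by under eq_fun do rewrite big_nil; exact: polyfunC.
by under eq_fun do rewrite big_cons; rewrite mulSn; exact: polyfunM.
Qed.

Lemma polyfunX zs n f k : polyfun zs n f -> polyfun zs (k * n) (fun w => f w ^+ k).
Proof.
move=> fP; elim: k => [|k IH].
  by under eq_fun do rewrite expr0; exact: polyfunC.
by under eq_fun do rewrite exprS; rewrite mulSn; exact: polyfunM.
Qed.

Lemma polyfun_sub zs zs' n f : (forall z, List.In z zs -> List.In z zs') ->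
  polyfun zs n f -> polyfun zs' n f.
Proof.
move=> sub; elim=> [c|z /sub|? ? ? _ ? _ ?|? ? ? ? _ ? _ ?|? ? ? ? _ ?].
- exact: polyfunC.
- exact: polyfun_var.
- exact: polyfunD.
- exact: polyfunM.
- by apply: polyfunW; eassumption.
Qed.

Definition pcoef zs n e Q := (forall w, (size (Q w) <= e)%N) /\
  forall k, polyfun zs n (fun w => (Q w)`_k).

(** Collect the powers of the head generator [g], by induction on the expression; [n] bounds both
    the degree in [g] and the degrees of the coefficients. *)
Lemma polyfun_cons_horner zs g n f : polyfun (g :: zs) n f ->
  exists2 Q, pcoef zs n n.+1 Q & forall w, f w = (Q w).[g w].
Proof.
elim=> [c|z|{}n f1 f2 _ [Q1 [s1 c1] e1] _ [Q2 [s2 c2] e2]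
       |{}n p f1 f2 _ [Q1 [s1 c1] e1] _ [Q2 [s2 c2] e2]
       |{}n p f1 np _ [Q1 [s1 c1] e1]].
- exists (fun=> c%:P); last by move=> w; rewrite hornerC.
  split=> [w|k]; first exact: size_polyC_leq1.
  under eq_fun do rewrite coefC.
  by case: (k == 0%N); exact: polyfunC.
- case=> [<-|zzs].
    exists (fun=> 'X); last by move=> w; rewrite hornerX.
    split=> [w|k]; first by rewrite size_polyX.
    under eq_fun do rewrite coefX.
    by apply: (@polyfunW _ 0) => //; exact: polyfunC.
  exists (fun w => (z w)%:P); last by move=> w; rewrite hornerC.
  split=> [w|k]; first by rewrite (leq_trans (size_polyC_leq1 _)).
  under eq_fun do rewrite coefC.
  case: (k == 0%N); first exact: polyfun_var.
  by apply: (@polyfunW _ 0) => //; exact: polyfunC.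
- exists (fun w => Q1 w + Q2 w); last by move=> w; rewrite hornerD e1 e2.
  split=> [w|k].
    by rewrite (leq_trans (size_polyD _ _))// geq_max s1 s2.
  by under eq_fun do rewrite coefD; exact: polyfunD.
- exists (fun w => Q1 w * Q2 w); last by move=> w; rewrite hornerM e1 e2.
  split=> [w|k].
    rewrite (leq_trans (size_polyMleq _ _))//.
    by move: (s1 w) (s2 w); move: (size _) (size _) => a b; lia.
  under eq_fun do rewrite coefM.
  by apply: polyfun_sum => i; exact: polyfunM.
- exists Q1 => //; split=> [w|k]; first exact: leq_trans (s1 w) _.
  by apply: polyfunW np _; exact: c1.
Qed.

(* Each step multiplies by the leading coefficient of [P]. *)
Lemma pseudo_reduction zs g n p e k P Q :
  pcoef zs p e.+1 P -> pcoef zs n (e + k) Q ->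
  exists2 Q', pcoef zs (n + k * p) e Q' &
    forall w, (P w).[g w] = 0 -> (P w)`_e ^+ k * (Q w).[g w] = (Q' w).[g w].
Proof.
move=> [sP cP]; elim: k n Q => [|k IH] n Q [sQ cQ].
  exists Q; last by move=> w _; rewrite mul1r.
  by rewrite mul0n addn0; split=> // w; rewrite -[e]addn0.
(* This combination has no term of degree [e + k]; at a root of [P w] its value is that of [Q w]
   times the coefficient of degree [e] of [P w]. *)
have [|Q' [sQ' cQ'] eQ'] :=
    IH (n + p)%N (fun w => (P w)`_e *: Q w - (Q w)`_(e + k) *: ('X^k * P w)).
  split=> [w|j].
    apply/leq_sizeP => j; rewrite leq_eqVlt => /predU1P[<-|lt_j].
      rewrite coefB !coefZ coefXnM ltnNge leq_addl/= addnK.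
      by rewrite mulrC subrr.
    rewrite coefB !coefZ coefXnM.
    have -> : (Q w)`_j = 0.
      by apply/(leq_sizeP _ _ (sQ w)); rewrite addnS.
    have -> : (P w)`_(j - k) = 0.
      by apply/(leq_sizeP _ _ (sP w)); lia.
    by rewrite if_same !mulr0 subr0.
  have -> : (fun w => ((P w)`_e *: Q w - (Q w)`_(e + k) *: ('X^k * P w))`_j) =
    (fun w => (Q w)`_j * (P w)`_e +
       -1 * ((Q w)`_(e + k) * (if (j < k)%N then 0 else (P w)`_(j - k)))).
    by apply/funext => w; rewrite coefB !coefZ coefXnM mulN1r [_ * (Q w)`_j]mulrC.
  apply: polyfunD; first exact: polyfunM.
  rewrite -[(n + p)%N]add0n; apply: polyfunM; first exact: polyfunC.
  apply: polyfunM => //; case: (j < k)%N => //.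
  by apply: (@polyfunW _ 0) => //; exact: polyfunC.
exists Q'; first by rewrite mulSn addnA.
move=> w P0; rewrite -eQ'// exprSr -mulrA; congr (_ * _).
by rewrite hornerD hornerN !hornerZ hornerM P0 !mulr0 subr0.
Qed.

(* The denominators [L] are what makes room for leading coefficients. *)
Definition growth W zs d := exists C, forall D,
  exists (L : T -> F) (I : finType) (B : I -> T -> F),
  [/\ forall w, W w -> L w != 0, (#|I| <= C * D.+1 ^ d)%N &
    forall f, polyfun zs D f ->
      exists c : I -> F, forall w, W w -> L w * f w = \sum_i c i * B i w].

Lemma growth0 W : growth W [::] 0.
Proof.
exists 1%N => D; exists (fun=> 1), unit, (fun _ _ => 1); split=> [w _|//|f fP].
- exact: oner_neq0.
- by rewrite card_unit.
have [c fE] : exists c, f = fun=> c.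
  elim: fP => [c|//|n f1 f2 _ [c1 ->] _ [c2 ->]
              |n p f1 f2 _ [c1 ->] _ [c2 ->]|n p f1 _ _ [c ->]].
  - by exists c.
  - by exists (c1 + c2).
  - by exists (c1 * c2).
  - by exists c.
exists (fun=> c) => w _; rewrite fE mul1r.
by rewrite (big_pred1 tt) ?mulr1// => -[].
Qed.

(** The powers of [g] up to [D] multiply the size of the spanning family by [D.+1], which raises the
    exponent by one. *)
Lemma growth_free W zs d g : growth W zs d -> growth W (g :: zs) d.+1.
Proof.
move=> [C CP]; exists C => D.
have [L [I [B [L0 cI BP]]]] := CP D.
exists L, (I * 'I_D.+1)%type, (fun x w => B x.1 w * g w ^+ nat_of_ord x.2); split=> //.
  by rewrite card_prod card_ord expnSr mulnA leq_mul2r cI orbT.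
move=> f /polyfun_cons_horner[Q [sQ cQ] fQ].
have [c cP] := choice (fun k => BP _ (cQ k)).
exists (fun x => c (nat_of_ord x.2) x.1) => w Ww.
rewrite -(pair_bigA _ (fun i (k : 'I__) => c k i * (B i w * g w ^+ k)))/= exchange_big/=.
rewrite fQ (horner_coef_wide _ (sQ w)) mulr_sumr; apply: eq_bigr => k _.
by rewrite mulrA cP// mulr_suml; apply: eq_bigr => i _; rewrite mulrA.
Qed.

(** Pseudo-division by [P] leaves only the powers of [g] below [e]. The coefficients then have
    degree at most [D + D.+1 * p], whose successor is [D.+1 * p.+1]: the constant changes, the
    exponent does not. *)
Lemma growth_algebraic W zs d g p e P : growth W zs d -> pcoef zs p e.+1 P ->
  (forall w, W w -> (P w)`_e != 0 /\ (P w).[g w] = 0) -> growth W (g :: zs) d.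
Proof.
move=> [C CP] cP P0; exists (e * C * p.+1 ^ d)%N => D.
have [L [I [B [L0 cI BP]]]] := CP (D + D.+1 * p)%N.
exists (fun w => (P w)`_e ^+ D.+1 * L w), (I * 'I_e)%type,
  (fun x w => B x.1 w * g w ^+ nat_of_ord x.2); split=> [w Ww||].
- by rewrite mulf_neq0 ?L0// expf_neq0//; case: (P0 _ Ww).
- rewrite card_prod card_ord mulnC -!mulnA leq_mul2l; apply/orP; right.
  rewrite (leq_trans cI)// leq_mul2l; apply/orP; right.
  rewrite -expnMn; case: (d) => [|d']; first by rewrite !expn0.
  by rewrite leq_exp2r//; nia.
move=> f /polyfun_cons_horner[Q [sQ cQ] fQ].
have [|Q' [sQ' cQ'] eQ'] := @pseudo_reduction _ g D p e D.+1 P Q cP.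
  by split=> // w; rewrite (leq_trans (sQ w))// leq_addl.
have [c cE] := choice (fun k => BP _ (cQ' k)).
exists (fun x => c (nat_of_ord x.2) x.1) => w Ww.
rewrite -(pair_bigA _ (fun i (k : 'I__) => c k i * (B i w * g w ^+ k)))/= exchange_big/=.
rewrite [_ * L w]mulrC -mulrA fQ eQ'; last by case: (P0 _ Ww).
rewrite (horner_coef_wide _ (sQ' w)) mulr_sumr; apply: eq_bigr => k _.
by rewrite mulrA cE// mulr_suml; apply: eq_bigr => i _; rewrite mulrA.
Qed.

Lemma left_kernel_exists (m n : nat) (A : 'M[F]_(m, n)) : (n < m)%N ->
  exists2 c : 'rV[F]_m, c != 0 & c *m A = 0.
Proof.
move=> nm; have : kermx A != 0.
  rewrite -mxrank_eq0 mxrank_ker -lt0n subn_gt0.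
  exact: leq_ltn_trans (rank_leq_col A) nm.
by case/rowV0Pn => c /sub_kermxP cA c0; exists c.
Qed.

Lemma growth_sub W W' zs d : (forall w, W' w -> W w) -> growth W zs d ->
  growth W' zs d.
Proof.
move=> sub [C CP]; exists C => D.
have [L [I [B [L0 cI BP]]]] := CP D.
exists L, I, B; split=> [w /sub /L0 //|//|f /BP[c cP]].
by exists c => w /sub /cP.
Qed.

Lemma growth_generators W zs : growth W zs (size zs).
Proof. by elim: zs => [|z zs IH]; [exact: growth0|exact: growth_free]. Qed.

(** The exponent [d] stands for a dimension. All pieces share the generators [zs], so refining the
    cover keeps the same polynomial functions. *)
Definition stratified W zs d := exists (I : finType) (U : I -> set T),
  (forall i, growth (U i) zs d) /\ forall w, W w -> exists i, U i w.

Lemma stratified_generators W zs : stratified W zs (size zs).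
Proof.
by exists unit, (fun=> W); split=> [_|w Ww]; [exact: growth_generators|exists tt].
Qed.

(** * Polynomial and algebraic functions over the generators *)

Definition polyf zs f := exists n, polyfun zs n f.

Lemma polyf_cst zs c : polyf zs (fun=> c).
Proof. by exists 0%N; exact: polyfunC. Qed.

Lemma polyf_var zs z : List.In z zs -> polyf zs z.
Proof. by exists 1%N; exact: polyfun_var. Qed.

Lemma polyfD zs f g : polyf zs f -> polyf zs g -> polyf zs (fun w => f w + g w).
Proof.
move=> [n fn] [p gp]; exists (maxn n p).
by apply: polyfunD; apply: polyfunW; try eassumption; [exact: leq_maxl|exact: leq_maxr].
Qed.

Lemma polyfM zs f g : polyf zs f -> polyf zs g -> polyf zs (fun w => f w * g w).
Proof. by move=> [n fn] [p gp]; exists (n + p)%N; exact: polyfunM. Qed.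

Lemma polyfN zs f : polyf zs f -> polyf zs (fun w => - f w).
Proof.
move=> fP; under eq_fun do rewrite -mulN1r.
by apply: polyfM => //; exact: polyf_cst.
Qed.

Lemma polyfX zs f k : polyf zs f -> polyf zs (fun w => f w ^+ k).
Proof. by move=> [n fn]; exists (k * n)%N; exact: polyfunX. Qed.

Lemma polyf_sum zs (I : Type) (r : seq I) (f : I -> T -> F) :
  (forall i, polyf zs (f i)) -> polyf zs (fun w => \sum_(i <- r) f i w).
Proof.
move=> fP; elim: r => [|i r IH].
  by under eq_fun do rewrite big_nil; exact: polyf_cst.
by under eq_fun do rewrite big_cons; exact: polyfD.
Qed.

(** The size bound is uniform in [w], so that only finitely many degrees occur. *)
Definition polypf zs Q := (exists N, forall w, (size (Q w) <= N)%N) /\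
  forall k, polyf zs (fun w => (Q w)`_k).

Lemma polypfC zs f : polyf zs f -> polypf zs (fun w => (f w)%:P).
Proof.
move=> fP; split=> [|k]; first by exists 1%N => w; exact: size_polyC_leq1.
by under eq_fun do rewrite coefC; case: eqP => // _; exact: polyf_cst.
Qed.

Lemma polypf_cst zs (Q : {poly F}) : polypf zs (fun=> Q).
Proof. by split=> [|k]; [exists (size Q)|exact: polyf_cst]. Qed.

Lemma polypfD zs P Q : polypf zs P -> polypf zs Q ->
  polypf zs (fun w => P w + Q w).
Proof.
move=> [[N sP] cP] [[M sQ] cQ]; split=> [|k].
  exists (maxn N M) => w; rewrite (leq_trans (size_polyD _ _))//.
  by rewrite geq_max !leq_max sP sQ orbT.
by under eq_fun do rewrite coefD; exact: polyfD.
Qed.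

Lemma polypfM zs P Q : polypf zs P -> polypf zs Q ->
  polypf zs (fun w => P w * Q w).
Proof.
move=> [[N sP] cP] [[M sQ] cQ]; split=> [|k].
  exists (N + M)%N => w; rewrite (leq_trans (size_polyMleq _ _))//.
  by rewrite (leq_trans (leq_pred _))// leq_add.
under eq_fun do rewrite coefM.
by apply: polyf_sum => i; exact: polyfM.
Qed.

Lemma polypfN zs P : polypf zs P -> polypf zs (fun w => - P w).
Proof.
move=> PP; under eq_fun do rewrite -mulN1r.
by apply: polypfM => //; exact: polypf_cst.
Qed.

Lemma polypfX zs P k : polypf zs P -> polypf zs (fun w => P w ^+ k).
Proof.
move=> PP; elim: k => [|k IH].
  by under eq_fun do rewrite expr0; exact: polypf_cst.
by under eq_fun do rewrite exprS; exact: polypfM.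
Qed.

(** [P w] is nonzero at each point of [W], but its degree may vary with the point. *)
Definition algebraic_over W zs g := exists P, polypf zs P /\
  forall w, W w -> P w != 0 /\ (P w).[g w] = 0.

(* The strata are refined according to the degree of [P w]. *)
Lemma stratified_cons W zs d g : stratified W zs d -> algebraic_over W zs g ->
  stratified W (g :: zs) d.
Proof.
move=> [I [U [gU WU]]] [P [[[N sP] cP] P0]].
have [n cn] := choice cP.
pose V (x : I * 'I_N) w :=
  [/\ U x.1 w, size (P w) = (nat_of_ord x.2).+1 & (P w).[g w] = 0].
exists (I * 'I_N)%type, V; split=> [[i k]|w Ww]; last first.
  have [Pw0 root_w] := P0 _ Ww; have [i Ui] := WU _ Ww.
  have lt_N : ((size (P w)).-1 < N)%N.
    by rewrite prednK ?lt0n ?size_poly_eq0.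
  exists (i, Ordinal lt_N); split=> //=.
  by rewrite prednK// lt0n size_poly_eq0.
(* [pcoef] bounds the size at every point; truncation ensures this and changes nothing on the
   stratum, where [P w] has degree [k]. *)
apply: (@growth_algebraic _ _ _ _ (\sum_(j < k.+1) n j)%N k
    (fun w => take_poly k.+1 (P w))).
- by apply: growth_sub (gU i) => w [].
- split=> [w|j]; first exact: size_take_poly.
  rewrite (_ : (fun w => _) =
    fun w => if (j < k.+1)%N then (P w)`_j else 0); last first.
    by apply/funext => w; rewrite coef_take_poly.
  case: ltnP => jk; last by apply: (@polyfunW _ 0) => //; exact: polyfunC.
  apply: polyfunW (cn j).
  by rewrite (bigD1 (Ordinal jk))//= leq_addr.
- move=> w [_ /= sPw Pg]; rewrite take_poly_id ?sPw//; split=> //.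
  by rewrite -[nat_of_ord k]/(k.+1.-1) -sPw -lead_coefE lead_coef_eq0 -size_poly_eq0 sPw.
Qed.

Lemma polyf_cons zs g f : polyf zs f -> polyf (g :: zs) f.
Proof. by move=> [n fn]; exists n; apply: polyfun_sub fn => z; right. Qed.

Lemma stratified_extend W zs d (X : eqType) (s : seq X) (g : X -> T -> F) :
  stratified W zs d -> {in s, forall x, algebraic_over W zs (g x)} ->
  exists zs', [/\ stratified W zs' d, forall f, polyf zs f -> polyf zs' f &
    {in s, forall x, polyf zs' (g x)}].
Proof.
move=> szs; elim: s => [|x s IH] algs; first by exists zs.
have [y ys|zs' [szs' sub gs]] := IH; first by apply: algs; rewrite inE ys orbT.
have [P [[sP cP] P0]] := algs x (mem_head _ _).
exists (g x :: zs'); split=> [|f /sub|y].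
- apply: stratified_cons szs' _; exists P; split=> //; split=> // k.
  exact/sub/cP.
- exact: polyf_cons.
- rewrite inE => /predU1P[->|/gs]; first by apply: polyf_var; left.
  exact: polyf_cons.
Qed.

Lemma stratified_extend1 W zs d g : stratified W zs d -> algebraic_over W zs g ->
  exists zs', [/\ stratified W zs' d, forall f, polyf zs f -> polyf zs' f &
    polyf zs' g].
Proof.
move=> szs alg; exists (g :: zs); split; first exact: stratified_cons.
  by move=> f; exact: polyf_cons.
by apply: polyf_var; left.
Qed.

Lemma algebraic_quotient W zs f h g : polyf zs f -> polyf zs h ->
  (forall w, W w -> f w != 0 /\ f w * g w = h w) -> algebraic_over W zs g.
Proof.
move=> fP hP fg; exists (fun w => (f w)%:P * 'X + (- h w)%:P); split.
  apply: polypfD; last exact/polypfC/polyfN.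
  by apply: polypfM; [exact: polypfC|exact: polypf_cst].
move=> w /fg[f0 fgw]; split; last by rewrite !hornerE fgw subrr.
apply: contraNneq f0 => /(congr1 (fun q : {poly F} => q`_1)).
by rewrite coefD coefMX !coefC/= addr0 => ->.
Qed.

(* More monomials of degree at most [D] in [d.+1] functions than dimensions. *)
Lemma growth_dependent W zs d (y : 'I_d.+1 -> T -> F) : growth W zs d ->
  (forall i, polyf zs (y i)) ->
  exists Q : {mpoly F[d.+1]}, Q != 0 /\ forall w, W w -> Q.@[y ^~ w] = 0.
Proof.
move=> [C CP] yP; have [n nP] := choice yP; pose e := (\max_i n i)%N.
(* There are [D.+1 ^ d.+1] monomials with exponents at most [D], of degree at most [d.+1 * (D * e)].
   Multiplied by [L], they are spanned by at most [C * (d.+1 * (D * e)).+1 ^ d <= D * D.+1 ^ d]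
   functions, which is fewer. *)
pose D := (C * (d.+1 * e).+1 ^ d)%N.
have [L [I [B [L0 cI BP]]]] := CP (d.+1 * (D * e))%N.
pose E := {ffun 'I_d.+1 -> 'I_D.+1}.
pose mon (al : E) w := \prod_i y i w ^+ al i.
have monP al : polyfun zs (d.+1 * (D * e)) (mon al).
  rewrite -[X in (X * _)%N](size_enum_ord) /mon.
  under eq_fun do rewrite -big_enum /=.
  apply: polyfun_prod => i; apply: (@polyfunW _ (al i * n i)).
    by rewrite leq_mul// ?leq_bigmax// -ltnS.
  exact: polyfunX.
have [c cE] := choice (fun al => BP _ (monP al)).
pose A := \matrix_(i < #|E|, j < #|I|) c (enum_val i) (enum_val j).
(* Row by row, [A] holds the coordinates of the monomials, so a left kernel vector is a linear
   relation between them; its entries become the coefficients of [Q]. *)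
have [|v v0 vA] := left_kernel_exists A.
  rewrite card_ffun !card_ord (leq_ltn_trans cI)//.
  rewrite expnS -[X in (_ < X * _)%N]/(D.+1).
  apply: (@leq_ltn_trans (D * D.+1 ^ d)%N).
    have -> : (D * D.+1 ^ d = C * ((d.+1 * e).+1 * D.+1) ^ d)%N.
      by rewrite expnMn mulnA.
    rewrite leq_mul2l; apply/orP; right.
    move: (D) => D0; case: (d) => [|d']; first by rewrite !expn0.
    by rewrite leq_exp2r//; nia.
  by rewrite ltn_mul2r expn_gt0/=.
pose mn (al : E) : 'X_{1..d.+1} := [multinom nat_of_ord (al i) | i < d.+1].
exists (\sum_(i < #|E|) v 0 i *: 'X_[mn (enum_val i)]); split; last first.
  move=> w Ww; apply: (mulfI (L0 _ Ww)); rewrite mulr0.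
  rewrite raddf_sum mulr_sumr/=.
  rewrite (eq_bigr (fun i => \sum_(j < #|I|) v 0 i * A i j * B (enum_val j) w)).
    rewrite exchange_big big1// => j _; rewrite -mulr_suml.
    by move/rowP: vA => /(_ j); rewrite !mxE => ->; rewrite mul0r.
  move=> i _; rewrite mevalZ mevalX.
  have -> : \prod_(k < d.+1) y k w ^+ (mn (enum_val i)) k = mon (enum_val i) w.
    by apply: eq_bigr => k _; rewrite mnmE.
  rewrite mulrCA cE// mulr_sumr.
  rewrite (reindex (fun j : 'I_#|I| => enum_val j)); last first.
    by apply: onW_bij; exact: enum_val_bij.
  by apply: eq_bigr => j _; rewrite mxE mulrA.
have [i vi] : exists i, v 0 i != 0.
  by apply/rV0Pn; exact: v0.
apply/eqP => /(congr1 (mcoeff (mn (enum_val i)))).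
rewrite raddf_sum mcoeff0 (bigD1 i)//= mcoeffZ mcoeffX eqxx mulr1 big1 ?addr0.
  by move/eqP; rewrite (negbTE vi).
move=> j ji; rewrite mcoeffZ mcoeffX.
case: eqP => [/mnmP mji|]; last by rewrite mulr0.
case/eqP: ji; apply: enum_val_inj; apply/ffunP => k; apply: val_inj.
by move: (mji k); rewrite !mnmE.
Qed.

(** [g] is a root of [f X^2 - 1], nonzero since its value at 0 is -1. This serves for inverse cubes
    of distances, whose squares are rational. *)
Lemma algebraic_sqr W zs f g : polyf zs f ->
  (forall w, W w -> f w * g w ^+ 2 = 1) -> algebraic_over W zs g.
Proof.
move=> fP fg; exists (fun w => (f w)%:P * 'X ^+ 2 + (- 1)%:P); split.
  apply: polypfD; last exact: polypf_cst.
  by apply: polypfM; [exact: polypfC|exact: polypf_cst].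
move=> w /fg fgw; split; last by rewrite hornerD hornerM !hornerC hornerXn fgw subrr.
apply/eqP => /(congr1 (horner^~ 0)).
rewrite hornerD hornerM !hornerC hornerXn expr0n mulr0 add0r.
by apply/eqP; rewrite oppr_eq0 oner_neq0.
Qed.

Lemma stratified_dependent W zs d (y : 'I_d.+1 -> T -> F) :
  stratified W zs d -> (forall i, polyf zs (y i)) ->
  exists Q : {mpoly F[d.+1]}, Q != 0 /\ forall w, W w -> Q.@[y ^~ w] = 0.
Proof.
move=> [I [U [gU WU]]] yP.
have [Q QP] := choice (fun i => growth_dependent (gU i) yP).
exists (\prod_i Q i); split.
  by apply/prodf_neq0 => i _; case: (QP i).
move=> w /WU[i Ui]; rewrite rmorph_prod/=.
by apply/eqP/prodf_eq0; exists i => //; case: (QP i) => _ ->.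
Qed.

End AlgebraicTowers.

(** * Nonvanishing of polynomials *)

Lemma poly_nonroot (F : numFieldType) (p : {poly F}) : p != 0 ->
  exists x, p.[x] != 0.
Proof.
move=> p0; pose s : seq F := [seq i%:R | i <- iota 0 (size p)].
have [/allP ps|/allPn[x _ px]] := boolP (all (root p) s); last by exists x.
have us : uniq s.
  by rewrite map_inj_uniq ?iota_uniq// => i j /eqP; rewrite eqr_nat => /eqP.
have /(max_poly_roots p0)/(_ us) : all (root p) s by apply/allP.
by rewrite size_map size_iota ltnn.
Qed.

Lemma base_expansion_inj n N (f g : 'I_n -> nat) :
  (forall i, (f i < N)%N) -> (forall i, (g i < N)%N) ->
  (\sum_i f i * N ^ i = \sum_i g i * N ^ i)%N -> f =1 g.
Proof.
elim: n f g => [|n IH] f g fN gN; first by move=> _ [].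
have N0 : (0 < N)%N by exact: leq_ltn_trans (fN ord0).
have shift (h : 'I_n.+1 -> nat) : (\sum_i h i * N ^ i =
    (\sum_(i < n) h (lift ord0 i) * N ^ i) * N + h ord0)%N.
  rewrite big_ord_recl expn0 muln1 addnC big_distrl/=; congr (_ + _)%N.
  by apply: eq_bigr => i _; rewrite /= expnSr mulnA.
rewrite !shift => /eqP.
move=> /eqP E; have E0 : f ord0 = g ord0.
  by move/(congr1 (modn^~ N)): E; rewrite !modnMDl !modn_small.
move/eqP: E; rewrite E0 eqn_add2r eqn_pmul2r// => /eqP /IH E.
move=> i; case: (unliftP ord0 i) => [j ->|->//].
by apply: E => k; [exact: fN|exact: gN].
Qed.

(* Kronecker substitution: the i-th variable becomes x^(N^i), N large. *)
Lemma mpoly_nonroot (F : numFieldType) n (Q : {mpoly F[n]}) : Q != 0 ->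
  exists v, Q.@[v] != 0.
Proof.
move=> Q0; pose N := msize Q.
pose code (m : 'X_{1..n}) := (\sum_(i < n) m i * N ^ i)%N.
have lt_N m : m \in msupp Q -> forall i, (m i < N)%N.
  move=> mQ i; rewrite (leq_trans _ (msize_mdeg_lt mQ))// ltnS.
  by rewrite mdegE (bigD1 i)//= leq_addr.
pose p : {poly F} := \sum_(m <- msupp Q) Q@_m *: 'X^(code m).
have [m0 m0Q] : exists m, m \in msupp Q.
  by exists (mlead Q); exact: mlead_supp.
have p0 : p != 0.
  apply/eqP => /(congr1 (fun q : {poly F} => q`_(code m0))).
  rewrite coef0 coef_sum (bigD1_seq m0)//= coefZ coefXn eqxx mulr1.
  rewrite big_seq_cond big1 ?addr0.
    by move=> /eqP; apply/negP; rewrite -mcoeff_msupp.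
  move=> m /andP[mQ mm0]; rewrite coefZ coefXn; case: eqP => [E|]; last first.
    by rewrite mulr0.
  case/eqP: mm0; apply/mnmP; apply: (@base_expansion_inj _ N) => //;
    exact: lt_N.
have [x px] := poly_nonroot p0; exists (fun i => x ^+ (N ^ i)).
rewrite mevalE (_ : \sum_(_ <- _) _ = p.[x])// horner_sum; apply: eq_bigr => m _.
rewrite hornerZ hornerXn; congr (_ * _).
rewrite /code -prodrXr; apply: eq_bigr => i _.
by rewrite -exprM mulnC.
Qed.

(** * The cube of [1 + X^2] is not a square *)

Section NotASquare.
Variable R : realFieldType.
Implicit Types p q : {poly R}.
Let theta : {poly R} := 1 + 'X^2.

Let size_theta : size theta = 3%N.
Proof. by rewrite /theta addrC size_polyDl ?size_polyXn// size_poly1. Qed.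

Let dvdp_theta_sqr p : theta %| p ^+ 2 -> theta %| p.
Proof.
have irr : irreducible_poly theta.
  apply: cubic_irreducible; first by rewrite size_theta.
  move=> x; rewrite rootE !hornerE; apply: lt0r_neq0.
  by rewrite ltr_pwDl ?sqr_ge0.
have [//|ndiv] := boolP (theta %| p).
by rewrite expr2 Gauss_dvdpr ?irreducible_poly_coprime// (negbTE ndiv).
Qed.

(* Infinite descent on the degree at the irreducible factor [1 + 'X^2]. *)
Lemma not_square_theta3 p q :
  p ^+ 2 = q ^+ 2 * (1 + 'X^2) ^+ 3 -> p = 0.
Proof.
have theta0 : theta != 0 by rewrite -size_poly_eq0 size_theta.
have [n] := ubnP (size p); elim: n p q => // n IH p q sp.
rewrite -/theta => E.
have [//|p0] := eqVneq p 0.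
have /dvdpP[u pE] : theta %| p.
  by apply: dvdp_theta_sqr; rewrite E exprS mulrCA dvdp_mulr.
have u0 : u != 0 by apply: contraNneq p0 => u0; rewrite pE u0 mul0r.
have E1 : u ^+ 2 = q ^+ 2 * theta.
  apply: (mulIf (expf_neq0 2 theta0)); rewrite -exprMn -pE E; ring.
have /dvdpP[v uE] : theta %| u.
  by apply: dvdp_theta_sqr; rewrite E1 dvdp_mull.
have E2 : v ^+ 2 * theta = q ^+ 2.
  by apply: (mulIf theta0); rewrite -E1 uE; ring.
have /dvdpP[w qE] : theta %| q.
  by apply: dvdp_theta_sqr; rewrite -E2 dvdp_mull.
have E3 : v ^+ 2 = w ^+ 2 * theta.
  by apply: (mulIf theta0); rewrite E2 qE; ring.
(* [u ^+ 2 = v ^+ 2 * theta ^+ 2 = w ^+ 2 * theta ^+ 3]: the pair [u], [w] solves the same equation,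
   and [u] has lower degree than [p]. *)
have := IH u w; rewrite -/theta => u_eq0.
rewrite pE u_eq0 ?mul0r//; last by rewrite uE exprMn E3; ring.
move: sp; rewrite pE size_mul// size_theta addn3/= ltnS; exact: leq_trans (leqnSn _).
Qed.

Lemma conjugate_product_neq0 p q : p != 0 ->
  q ^+ 2 * (1 + 'X^2) ^+ 3 - p ^+ 2 != 0.
Proof.
move=> p0; apply: contraNneq p0 => /eqP; rewrite subr_eq0 => /eqP E.
exact/eqP/(@not_square_theta3 _ q).
Qed.

End NotASquare.

(** * Reduced equations *)

Ltac solve_polyf := repeat first [assumption | by auto | apply: polyfN
  | apply: polyfD | apply: polyfM | apply: polyfX | apply: polyf_cst].
Ltac solve_polypf := repeat first [assumption | apply: polypf_cst | apply: polypfN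
  | apply: polypfD | apply: polypfM | apply: polypfX | apply: polypfC; solve_polyf].

Section ReducedEquations.
Variable R : realType.

(** Inverse cube of the distance from [(x, 0)] to each of [(0, 1)] and [(0, -1)]. *)
Definition rho (x : R) : R := (Num.sqrt (1 + x ^+ 2)) ^- 3.

Let one_sqr_gt0 (x : R) : 0 < 1 + x ^+ 2.
Proof. by rewrite ltr_pwDl ?sqr_ge0. Qed.

Lemma rho_sqr (x : R) : (1 + x ^+ 2) ^+ 3 * rho x ^+ 2 = 1.
Proof.
rewrite /rho exprVn -exprM (exprM _ 2 3) sqr_sqrtr ?ltW//.
by rewrite mulfV// expf_neq0// gt_eqF.
Qed.

(* Masses and abscissas of the bodies on the axis, the two other bodies being at
   (0, 1) and (0, -1). *)
Let T := (('I_5 -> R) * ('I_4 -> R))%type.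
Implicit Types (w : T) (i j k l : 'I_4).

Definition mass i w : R := w.1 (lift ord_max i).
Definition mass_off w : R := w.1 ord_max.
Definition absc i w : R := w.2 i.
Definition rhoa i w : R := rho (absc i w).
Definition cubeinv i j w : R := `|absc i w - absc j w| ^- 3.
Definition K i j w : R := (cubeinv i j w - rhoa j w) * (absc j w - absc i w).
Definition B i w : R := - (2 * (rhoa i w - 8^-1) * absc i w).

Definition reduced_solution w := injective w.2 /\
  forall i j k l, uniq [:: i; j; k; l] ->
  mass j w * K i j w + mass k w * K i k w + mass l w * K i l w
    + mass_off w * B i w = 0.

(* [K] restricted to three indices has zero diagonal, determinant [G i j k], and
   [cramer e i j k] is [G i j k] times the [i]-th coordinate of [K^-1 e].  [N i j k l]
   is the minor of the 4 x 5 matrix [K | B] without column [l]. *)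
Definition G i j k w : R :=
  K i j w * K j k w * K k i w + K i k w * K j i w * K k j w.
Definition cramer (e : 'I_4 -> T -> R) i j k w : R :=
  - (K j k w * K k j w) * e i w + K i k w * K k j w * e j w
    + K i j w * K j k w * e k w.
Definition N i j k l w : R := G i j k w * B l w -
  (K l i w * cramer B i j k w + K l j w * cramer B j i k w
    + K l k w * cramer B k j i w).

Lemma cubeinv_sym i j : cubeinv i j = cubeinv j i.
Proof. by apply/funext => w; rewrite /cubeinv distrC. Qed.

Lemma cubeinv_sqr i j w : injective w.2 -> i != j ->
  (absc i w - absc j w) ^+ 6 * cubeinv i j w ^+ 2 = 1.
Proof.
move=> inj ij; have d0 : absc i w - absc j w != 0.
  by rewrite subr_eq0; apply: contraNneq ij => /inj ->.
rewrite /cubeinv exprVn -exprM -normrX ger0_norm ?exprn_even_ge0//.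
by rewrite mulfV// expf_neq0.
Qed.

(** Geometrically, body [j] is then as far from body [i] as from the two bodies off the axis. *)
Lemma K_eq0 i j w : injective w.2 -> i != j -> K i j w = 0 ->
  (absc i w - absc j w) ^+ 2 = 1 + absc j w ^+ 2.
Proof.
move=> inj ij /eqP; have d0 : absc j w - absc i w != 0.
  by rewrite subr_eq0; apply: contraNneq ij => /inj ->.
rewrite mulf_eq0 (negbTE d0) orbF subr_eq0 => /eqP /invr_inj /eqP.
rewrite eqrXn2 ?sqrtr_ge0// => /eqP E.
by rewrite -(real_normK (num_real (absc i w - absc j w))) E sqr_sqrtr ?ltW.
Qed.

(** Otherwise each pair satisfies one of the two equations given by [K_eq0]. Of the three pairs
    containing index 0, two satisfy the equation of the same kind; [far] and [near] exclude the two
    kinds. *)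
Lemma exists_regular_pair w : injective w.2 ->
  exists i j, [/\ i != j, K i j w != 0 & K j i w != 0].
Proof.
move=> inj; apply: contrapT => none.
have pair i j : i != j -> (absc i w - absc j w) ^+ 2 = 1 + absc j w ^+ 2 \/
    (absc i w - absc j w) ^+ 2 = 1 + absc i w ^+ 2.
  move=> ij; have [/K_eq0|Kij] := eqVneq (K i j w) 0; first by left; auto.
  have [/K_eq0 E|Kji] := eqVneq (K j i w) 0; last by case: none; exists i, j.
  by right; rewrite -sqrrN opprB E// eq_sym.
have neq i j : i != j -> absc i w <> absc j w.
  by move=> /eqP ij /inj.
(* The equations expand to [x^2 - 2xy = 1] and [x^2 - 2xz = 1], whence [x = 0], which is absurd. *)
have far (x y z : R) : y <> z -> (x - y) ^+ 2 = 1 + y ^+ 2 ->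
  (x - z) ^+ 2 = 1 + z ^+ 2 -> False.
  move=> yz Ey Ez; have /eqP : x * (y - z) = 0 by lra.
  rewrite mulf_eq0 subr_eq0 => /orP[|]/eqP // x0.
  by move: Ey; rewrite x0; lra.
(* [y] and [z] are the two roots of [t^2 - 2xt - 1], so [yz = -1] and [(y - z)^2 = y^2 + z^2 + 2],
   too large for either alternative. *)
have near (x y z : R) : y <> z -> (x - y) ^+ 2 = 1 + x ^+ 2 ->
    (x - z) ^+ 2 = 1 + x ^+ 2 ->
    (y - z) ^+ 2 = 1 + z ^+ 2 \/ (y - z) ^+ 2 = 1 + y ^+ 2 -> False.
  move=> yz Ey Ez.
  have /eqP : (y - z) * (y + z - x *+ 2) = 0 by lra.
  rewrite mulf_eq0 !subr_eq0 => /orP[|]/eqP // yz2.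
  have zE : z = x *+ 2 - y by lra.
  by rewrite zE => -[]; nra.
pose o1 : 'I_4 := lift ord0 (lift ord0 ord0).
pose o2 : 'I_4 := lift ord0 ord0. pose o3 : 'I_4 := ord_max.
have n12 := neq o1 o2 isT; have n13 := neq o1 o3 isT; have n23 := neq o2 o3 isT.
have p12 := pair o1 o2 isT; have p13 := pair o1 o3 isT; have p23 := pair o2 o3 isT.
case: (pair ord0 o1 isT); case: (pair ord0 o2 isT); case: (pair ord0 o3 isT) => E3 E2 E1.
all: by [apply: (far _ _ _ n12 E1 E2)|apply: (far _ _ _ n13 E1 E3)
  |apply: (far _ _ _ n23 E2 E3)|apply: (near _ _ _ n12 E1 E2 p12)
  |apply: (near _ _ _ n13 E1 E3 p13)|apply: (near _ _ _ n23 E2 E3 p23)].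
Qed.

(** The squares of [rhoa] and [cubeinv] are inverses of polynomials in the abscissas, so adjoining
    them keeps the dimension; [K] and [B] are then polynomial functions. *)
Lemma K_extend W zs d (s : seq 'I_4) : (forall w, W w -> injective w.2) ->
  stratified W zs d -> {in s, forall i, polyf zs (absc i)} ->
  exists zs', [/\ stratified W zs' d, forall f, polyf zs f -> polyf zs' f,
    {in s, forall i, polyf zs' (B i)} &
    {in s &, forall i j, i != j -> [/\ polyf zs' (rhoa i),
      polyf zs' (cubeinv i j) & polyf zs' (K i j)]}].
Proof.
move=> inj szs aP.
have [i si|zs1 [szs1 sub1 rP]] := stratified_extend szs (s := s) (g := rhoa).
  apply: (algebraic_sqr (f := fun w => (1 + absc i w ^+ 2) ^+ 3)).
    by apply/polyfX/polyfD; [exact: polyf_cst|exact/polyfX/aP].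
  by move=> w _; exact: rho_sqr.
pose s2 := [seq p <- [seq (i, j) | i <- s, j <- s] | p.1 != p.2].
have [[i j]|zs2 [szs2 sub2 dP]] :=
    stratified_extend szs1 (s := s2) (g := fun p => cubeinv p.1 p.2).
  rewrite mem_filter => /andP[/= ij /allpairsP[[i' j'] [/= si sj []]]].
  move=> ii jj; rewrite -{}ii -{}jj {i' j'} in si sj *.
  apply: (algebraic_sqr (f := fun w => (absc i w - absc j w) ^+ 6)).
    by apply/polyfX/polyfD; [|apply: polyfN]; exact/sub1/aP.
  by move=> w /inj wi; exact: cubeinv_sqr.
exists zs2; split=> // [f /sub1/sub2//|i si|i j si sj ij].
  apply/polyfN/polyfM; last exact/sub2/sub1/aP.
  apply: polyfM; first exact: polyf_cst.
  by apply: polyfD; [exact/sub2/rP|exact: polyf_cst].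
have dij : polyf zs2 (cubeinv i j).
  by apply: (dP (i, j)); rewrite mem_filter ij allpairs_f.
split=> //; first exact/sub2/rP.
apply: polyfM; apply: polyfD; rewrite //.
- exact/polyfN/sub2/rP.
- exact/sub2/sub1/aP.
- exact/polyfN/sub2/sub1/aP.
Qed.

(* [p0 + rho p1] and its conjugate [p0 - rho p1] have a nonzero product. *)
Lemma algebraic_conjugate W zs (g : T -> R) (p0 p1 : T -> {poly R}) :
  polypf zs p0 -> polypf zs p1 ->
  (forall w, W w -> p1 w != 0 /\
    (p0 w).[g w] + rho (g w) * (p1 w).[g w] = 0) ->
  algebraic_over W zs g.
Proof.
move=> p0P p1P root; exists (fun w => p0 w ^+ 2 * (1 + 'X^2) ^+ 3 - p1 w ^+ 2).
split=> [|w /root[p1w E]].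
  apply: polypfD; last exact/polypfN/polypfX.
  by apply: polypfM; [exact: polypfX|exact: polypf_cst].
split; first exact: conjugate_product_neq0.
have -> : (p0 w ^+ 2 * (1 + 'X^2) ^+ 3 - p1 w ^+ 2).[g w] =
    (p0 w).[g w] ^+ 2 * (1 + g w ^+ 2) ^+ 3 - (p1 w).[g w] ^+ 2.
  by rewrite hornerD hornerN hornerM !horner_exp hornerD hornerC hornerXn.
have -> : (p0 w).[g w] = - (rho (g w) * (p1 w).[g w]) by apply/eqP; rewrite -addr_eq0 E.
rewrite sqrrN exprMn mulrAC [rho _ ^+ 2 * _]mulrC.
by rewrite rho_sqr mul1r subrr.
Qed.

(** All nine coordinates are polynomial functions of generators whose growth exponent is 5 on each
    piece. *)
Definition five_dimensional (W : set T) := exists zs, [/\ stratified W zs 5,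
  forall i, polyf zs (mass i), polyf zs mass_off & forall i, polyf zs (absc i)].

Lemma uniq4_mem (i j k l x : 'I_4) : uniq [:: i; j; k; l] -> x \in [:: i; j; k; l].
Proof.
move=> /card_uniqP u.
have c : #|[:: i; j; k; l]| = #|'I_4| by rewrite u card_ord.
by rewrite (elimT (subset_cardP c)) ?subset_predT.
Qed.

Lemma uniq4_swap (i j k l : 'I_4) : uniq [:: i; j; k; l] -> uniq [:: j; i; k; l].
Proof. by rewrite (perm_uniq (s2 := [:: i; j; k; l])) //; apply/permP => a /=; lia. Qed.

Lemma uniq4_swap13 (i j k l : 'I_4) : uniq [:: i; j; k; l] -> uniq [:: k; j; i; l].
Proof. by rewrite (perm_uniq (s2 := [:: i; j; k; l])) //; apply/permP => a /=; lia. Qed.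

Lemma uniq4_rot (i j k l : 'I_4) : uniq [:: i; j; k; l] -> uniq [:: j; k; l; i].
Proof. by rewrite -(rot_uniq 1). Qed.

(** Cramer's rule: the first row of the adjugate of [K] on [i], [j], [k], applied to the equations
    of these bodies, eliminates the masses of [j] and [k]. *)
Lemma mass_cramer i j k l w : reduced_solution w -> uniq [:: i; j; k; l] ->
  G i j k w * mass i w =
    - (mass l w * cramer (K^~ l) i j k w + mass_off w * cramer B i j k w).
Proof.
move=> [_ row] u; have ri := row _ _ _ _ u; have rj := row _ _ _ _ (uniq4_swap u).
have rk := row _ _ _ _ (uniq4_rot (uniq4_rot u)).
apply/eqP; rewrite -subr_eq0 opprK; apply/eqP.
set ei := (X in X = 0) in ri; set ej := (X in X = 0) in rj.
set ek := (X in X = 0) in rk.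
transitivity (- (K j k w * K k j w) * ei + K i k w * K k j w * ej
    + K i j w * K j k w * ek); last by rewrite ri rj rk !mulr0 !addr0.
by rewrite /ei /ej /ek /G /cramer; ring.
Qed.

Lemma G_swap i j k : G j i k = G i j k.
Proof. by apply/funext => w; rewrite /G; ring. Qed.

Lemma G_swap13 i j k : G k j i = G i j k.
Proof. by apply/funext => w; rewrite /G; ring. Qed.

(** Multiply the equation of body [l] by [G i j k] and substitute the masses of [i], [j], [k] by
    [mass_cramer]. *)
Lemma mass_off_elimination i j k l w : reduced_solution w -> uniq [:: i; j; k; l] ->
  N i j k l w * mass_off w = mass l w *
    (K l i w * cramer (K^~ l) i j k w + K l j w * cramer (K^~ l) j i k w
     + K l k w * cramer (K^~ l) k j i w).
Proof.
move=> sol u; have Ci := mass_cramer sol u.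
have Cj := mass_cramer sol (uniq4_swap u); rewrite G_swap in Cj.
have Ck := mass_cramer sol (uniq4_swap13 u); rewrite G_swap13 in Ck.
have [_ row] := sol; have := row _ _ _ _ (uniq4_rot (uniq4_rot (uniq4_rot u))).
move/(congr1 ( *%R (G i j k w))); rewrite mulr0 /N => rl.
have {}rl : K l i w * (G i j k w * mass i w) + K l j w * (G i j k w * mass j w)
  + K l k w * (G i j k w * mass k w) + G i j k w * (mass_off w * B l w) = 0.
  by rewrite -[RHS]rl; ring.
apply/eqP; rewrite -subr_eq0 -rl Ci Cj Ck; apply/eqP; ring.
Qed.

Lemma polyf_cramer zs (e : 'I_4 -> T -> R) i j k : uniq [:: i; j; k] ->
  (forall x y, x != y -> polyf zs (K x y)) ->
  {in [:: i; j; k], forall x, polyf zs (e x)} -> polyf zs (cramer e i j k).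
Proof.
rewrite /= !inE negb_or andbT => /andP[/andP[ij ik] jk] kP eP.
have kj : k != j by rewrite eq_sym.
have [ei ej ek] : [/\ polyf zs (e i), polyf zs (e j) & polyf zs (e k)].
  by split; apply: eP; rewrite !inE eqxx ?orbT.
rewrite /cramer; solve_polyf.
Qed.

Lemma polyf_G zs i j k : uniq [:: i; j; k] ->
  (forall x y, x != y -> polyf zs (K x y)) -> polyf zs (G i j k).
Proof.
rewrite /= !inE negb_or andbT => /andP[/andP[ij ik] jk] kP.
have [ji ki kj] : [/\ j != i, k != i & k != j] by split; rewrite eq_sym.
rewrite /G; solve_polyf.
Qed.

Lemma uniq4_3 (i j k l : 'I_4) : uniq [:: i; j; k; l] -> uniq [:: i; j; k].
Proof. by rewrite -[_ :: _]/([:: i; j; k] ++ [:: l]) cat_uniq => /andP[]. Qed.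

Lemma five_dimensional_cramer W zs i j k l : uniq [:: i; j; k; l] ->
  (forall w, W w -> reduced_solution w /\ G i j k w != 0) -> stratified W zs 5 ->
  (forall x, polyf zs (absc x)) -> polyf zs (mass l) -> polyf zs mass_off ->
  (forall x y, x != y -> polyf zs (K x y)) -> (forall x, polyf zs (B x)) ->
  five_dimensional W.
Proof.
move=> u WP szs aP mlP moP kP bP.
have lP x : x \in [:: i; j; k] -> x != l.
  apply: contraTneq => ->.
  by have := uniq4_rot (uniq4_rot (uniq4_rot u)); rewrite cons_uniq => /andP[].
have massP x y z : uniq [:: x; y; z; l] -> {subset [:: x; y; z] <= [:: i; j; k]} ->
    G x y z = G i j k -> algebraic_over W zs (mass x).
  move=> u' sub GE; apply: (algebraic_quotient (f := G i j k) (h := fun w =>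
    - (mass l w * cramer (K^~ l) x y z w + mass_off w * cramer B x y z w))).
  - exact: polyf_G (uniq4_3 u) kP.
  - have c1 : polyf zs (cramer (K^~ l) x y z).
      by apply: (polyf_cramer (uniq4_3 u') kP) => t /sub /lP; exact: kP.
    have c2 : polyf zs (cramer B x y z).
      by apply: (polyf_cramer (uniq4_3 u') kP) => t _.
    solve_polyf.
  - move=> w /WP[sol G0]; split=> //; rewrite -GE; exact: mass_cramer.
have [x|zs' [szs' sub mP]] := stratified_extend szs (s := [:: i; j; k]) (g := mass).
  rewrite !inE => /or3P[] /eqP ->.
  - exact: (massP i j k).
  - apply: (massP j i k (uniq4_swap u)); last exact: G_swap.
    by move=> y; rewrite !inE orbCA.
  - apply: (massP k j i (uniq4_swap13 u)); last exact: G_swap13.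
    by move=> y; rewrite !inE => /or3P[] ->; rewrite ?orbT.
exists zs'; split=> // [x||x]; [|exact: sub|exact: sub].
have := uniq4_mem x u; rewrite -[_ :: _]/([:: i; j; k] ++ [:: l]) mem_cat.
by rewrite mem_seq1 => /orP[/mP//|/eqP->]; exact: sub.
Qed.

(** The generators are [mass l] and the four abscissas: dividing by [N] gives [mass_off], then
    dividing by [G] gives the other masses. *)
Lemma five_dimensional_generic i j k l : uniq [:: i; j; k; l] ->
  five_dimensional
    [set w | [/\ reduced_solution w, G i j k w != 0 & N i j k l w != 0]].
Proof.
move=> u; set W := [set w | _].
pose zs0 : list (T -> R) := [:: mass l; absc i; absc j; absc k; absc l].
have szs0 : stratified W zs0 5 := stratified_generators W zs0.
have aP x : polyf zs0 (absc x).
  have := uniq4_mem x u; rewrite !inE => /or4P[] /eqP ->; apply: polyf_var => /=; tauto.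
have mlP : polyf zs0 (mass l) by apply: polyf_var => /=; tauto.
have [w [[]]//|//|zs1 [szs1 sub1 bP0 kP0]] := K_extend (s := enum 'I_4) _ szs0.
have bP x : polyf zs1 (B x) by apply: bP0; rewrite mem_enum.
have kP x y : x != y -> polyf zs1 (K x y).
  by move=> xy; case: (kP0 x y); rewrite ?mem_enum.
have [li lj lk] : [/\ l != i, l != j & l != k].
  have := uniq4_rot (uniq4_rot (uniq4_rot u)).
  by rewrite /= !inE !negb_or => /andP[/and3P[]].
have crP e x y z : uniq [:: x; y; z; l] -> (forall t, t != l -> polyf zs1 (e t)) ->
    polyf zs1 (cramer e x y z).
  move=> u' eP; apply: (polyf_cramer (uniq4_3 u') kP) => t txyz; apply: eP.
  apply: contraTneq txyz => ->.
  by have := uniq4_rot (uniq4_rot (uniq4_rot u')); rewrite cons_uniq => /andP[].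
have kPl t : t != l -> polyf zs1 (K t l) by exact: kP.
have GP : polyf zs1 (G i j k) by exact: polyf_G (uniq4_3 u) kP.
have c1 := crP _ _ _ _ u kPl; have c1' := crP B _ _ _ u (fun t _ => bP t).
have c2 := crP _ _ _ _ (uniq4_swap u) kPl.
have c2' := crP B _ _ _ (uniq4_swap u) (fun t _ => bP t).
have c3 := crP _ _ _ _ (uniq4_swap13 u) kPl.
have c3' := crP B _ _ _ (uniq4_swap13 u) (fun t _ => bP t).
have mlP1 := sub1 _ mlP.
have [|zs2 [szs2 sub2 moP]] := @stratified_extend1 _ _ W zs1 5 mass_off szs1.
  apply: (algebraic_quotient (f := N i j k l) (h := fun w => mass l w *
    (K l i w * cramer (K^~ l) i j k w + K l j w * cramer (K^~ l) j i k w
     + K l k w * cramer (K^~ l) k j i w))).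
  - rewrite /N; solve_polyf.
  - solve_polyf.
  - by move=> w [sol _ N0]; split=> //; exact: mass_off_elimination.
apply: (five_dimensional_cramer u _ szs2) => //.
- by move=> w [].
- by move=> x; exact/sub2/sub1.
- exact: sub2.
- by move=> x y xy; exact/sub2/kP.
- by move=> x; exact/sub2.
Qed.

(** The sign of [absc j - absc i] when these differ. It turns [cubeinv i j] into
    [side i j / (absc j - absc i)^3], free of absolute values. *)
Definition side i j w : R := cubeinv i j w * (absc j w - absc i w) ^+ 3.

Lemma side_sqr i j w : injective w.2 -> i != j -> side i j w ^+ 2 = 1.
Proof.
move=> inj ij; rewrite -(cubeinv_sqr inj ij) /side; ring.
Qed.

(** In [N i j k l], [rho] of [absc l] occurs only in [B l], and linearly. Clearing denominators
    turns [N = 0] into an equation [p0 + rho p1 = 0] for [absc l], with coefficients built from the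
    other abscissas and signs. *)
Lemma extend_absc_triple W zs i j k l : uniq [:: i; j; k; l] ->
  (forall w, W w -> [/\ reduced_solution w, G i j k w != 0 & N i j k l w = 0]) ->
  stratified W zs 5 -> {in [:: i; j; k], forall x, polyf zs (absc x)} ->
  exists zs', [/\ stratified W zs' 5, forall f, polyf zs f -> polyf zs' f &
    polyf zs' (absc l)].
Proof.
move=> u WP szs aP.
have inj w : W w -> injective w.2 by case/WP => -[].
have [zs1 [szs1 sub1 bP kP0]] := K_extend inj szs aP.
have xl x : x \in [:: i; j; k] -> x != l.
  apply: contraTneq => ->.
  by have := uniq4_rot (uniq4_rot (uniq4_rot u)); rewrite cons_uniq => /andP[].
have [x xs|zs2 [szs2 sub2 sP]] :=
    stratified_extend szs1 (s := [:: i; j; k]) (g := side^~ l).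
  apply: (algebraic_sqr (f := fun=> 1)); first exact: polyf_cst.
  by move=> w /inj wi; rewrite mul1r side_sqr// xl.
suff alg : algebraic_over W zs2 (absc l).
  have [zs3 [szs3 sub3 ?]] := stratified_extend1 szs2 alg.
  by exists zs3; split=> // f /sub1/sub2/sub3.
have [xi xj xk] : [/\ i \in [:: i; j; k], j \in [:: i; j; k] & k \in [:: i; j; k]].
  by rewrite !inE !eqxx !orbT.
have := uniq4_3 u; rewrite /= !inE negb_or andbT => /andP[/andP[ij ik] jk].
have [ji ki kj] : [/\ j != i, k != i & k != j] by split; rewrite eq_sym.
have KP x y : x \in [:: i; j; k] -> y \in [:: i; j; k] -> x != y -> polyf zs2 (K x y).
  by move=> xx yy xy; apply: sub2; case: (kP0 x y).
have [Kij Kik Kji] : [/\ polyf zs2 (K i j), polyf zs2 (K i k) & polyf zs2 (K j i)].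
  by split; exact: KP.
have [Kjk Kki Kkj] : [/\ polyf zs2 (K j k), polyf zs2 (K k i) & polyf zs2 (K k j)].
  by split; exact: KP.
have [Bi Bj Bk] : [/\ polyf zs2 (B i), polyf zs2 (B j) & polyf zs2 (B k)].
  by split; apply: sub2; exact: bP.
have [ri rj rk] : [/\ polyf zs2 (rhoa i), polyf zs2 (rhoa j) & polyf zs2 (rhoa k)].
  by split; apply: sub2; [case: (kP0 i j)|case: (kP0 j i)|case: (kP0 k i)].
have [ai aj ak] : [/\ polyf zs2 (absc i), polyf zs2 (absc j) & polyf zs2 (absc k)].
  by split; apply/sub2/sub1; exact: aP.
have [si sj sk] : [/\ polyf zs2 (side i l), polyf zs2 (side j l) & polyf zs2 (side k l)].
  by split; exact: sP.
have GP : polyf zs2 (G i j k) by rewrite /G; solve_polyf.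
have [ci cj ck] : [/\ polyf zs2 (cramer B i j k), polyf zs2 (cramer B j i k)
  & polyf zs2 (cramer B k j i)] by split; rewrite /cramer; solve_polyf.
(* The variable stands for [absc l]; there [cub x] takes the value [K l x * (absc l - absc x)^2]. *)
pose lin x w : {poly R} := 'X + (- absc x w)%:P.
pose cub x w : {poly R} := (rhoa x w)%:P * lin x w ^+ 3 + (- side x l w)%:P.
pose sq w := (lin i w * lin j w * lin k w) ^+ 2.
pose p1 w := (-2 * G i j k w)%:P * 'X * sq w.
pose p0 w := (2 * 8^-1 * G i j k w)%:P * 'X * sq w +
  - ((cramer B i j k w)%:P * cub i w * (lin j w * lin k w) ^+ 2
   + (cramer B j i k w)%:P * cub j w * (lin i w * lin k w) ^+ 2
   + (cramer B k j i w)%:P * cub k w * (lin i w * lin j w) ^+ 2).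
apply: (algebraic_conjugate (p0 := p0) (p1 := p1)).
- rewrite /p0 /sq /cub /lin; solve_polypf.
- rewrite /p1 /sq /lin; solve_polypf.
move=> w /WP[_ G0 N0]; split.
  rewrite /p1 /sq /lin !polyCN !mulf_neq0 ?expf_neq0 ?mulf_neq0 ?polyX_eq0
    ?polyXsubC_eq0 ?polyC_eq0//.
  by rewrite mulf_neq0// oppr_eq0 pnatr_eq0.
transitivity (((absc l w - absc i w) * (absc l w - absc j w) *
    (absc l w - absc k w)) ^+ 2 * N i j k l w); last by rewrite N0 mulr0.
have EK x : K l x w = (cubeinv x l w - rhoa x w) * (absc x w - absc l w).
  by rewrite /K cubeinv_sym.
rewrite /N !EK /p0 /p1 /sq /cub /lin /side.
rewrite !(horner_exp, hornerD, hornerN, hornerM, hornerX, hornerC).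
move: (G i j k w) (cramer B i j k w) (cramer B j i k w) (cramer B k j i w).
rewrite /B /rhoa; move=> g c1 c2 c3; ring.
Qed.
End ReducedEquations.

(** * Strata on which a minor vanishes *)

Section Strata.
Variable R : realType.
Let T := (('I_5 -> R) * ('I_4 -> R))%type.
Implicit Types (w : T) (i j k l : 'I_4) (W : set T).

(** [G i j k] is linear in [rho] of [absc k], which enters through [K i k] and [K j k], one in each
    term; so [G = 0] is again an equation [p0 + rho p1 = 0], now for [absc k]. *)
Lemma extend_absc_pair W zs i j k : uniq [:: i; j; k] ->
  (forall w, W w -> [/\ injective w.2, K i j w != 0 & G i j k w = 0]) ->
  stratified W zs 5 -> {in [:: i; j], forall x, polyf zs (absc x)} ->
  exists zs', [/\ stratified W zs' 5, forall f, polyf zs f -> polyf zs' f &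
    polyf zs' (absc k)].
Proof.
move=> u WP szs aP.
have inj w : W w -> injective w.2 by case/WP.
have [zs1 [szs1 sub1 bP kP0]] := K_extend inj szs aP.
move: u; rewrite /= !inE negb_or andbT => /andP[/andP[ij ik] jk].
have ji : j != i by rewrite eq_sym.
have [x xs|zs2 [szs2 sub2 sP]] :=
    stratified_extend szs1 (s := [:: i; j]) (g := (@side R)^~ k).
  apply: (algebraic_sqr (f := fun=> 1)); first exact: polyf_cst.
  move=> w /inj wi; rewrite mul1r side_sqr//.
  by move: xs; rewrite !inE => /orP[]/eqP->.
suff alg : algebraic_over W zs2 (absc k).
  have [zs3 [szs3 sub3 ?]] := stratified_extend1 szs2 alg.
  by exists zs3; split=> // f /sub1/sub2/sub3.
have [xi xj] : i \in [:: i; j] /\ j \in [:: i; j] by rewrite !inE !eqxx !orbT.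
have [Kij Kji] : polyf zs2 (K i j) /\ polyf zs2 (K j i).
  by split; apply: sub2; [case: (kP0 i j)|case: (kP0 j i)].
have [ri rj] : polyf zs2 (rhoa i) /\ polyf zs2 (rhoa j).
  by split; apply: sub2; [case: (kP0 i j)|case: (kP0 j i)].
have [ai aj] : polyf zs2 (absc i) /\ polyf zs2 (absc j).
  by split; apply/sub2/sub1; exact: aP.
have [si sj] : polyf zs2 (side i k) /\ polyf zs2 (side j k).
  by split; exact: sP.
(* At [X = absc k], [K k x * (X - absc x)^2] is [- cub x], and [K x k * (X - absc x)^2] is
   [side x k - rho X * (X - absc x)^3]. *)
pose lin x w : {poly R} := 'X + (- absc x w)%:P.
pose cub x w : {poly R} := (side x k w)%:P + - ((rhoa x w)%:P * lin x w ^+ 3).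
pose p1 w := (K i j w)%:P * lin j w ^+ 3 * cub i w
  + (K j i w)%:P * lin i w ^+ 3 * cub j w.
pose p0 w := - ((K i j w * side j k w)%:P * cub i w
  + (K j i w * side i k w)%:P * cub j w).
apply: (algebraic_conjugate (p0 := p0) (p1 := p1)).
- rewrite /p0 /cub /lin; solve_polypf.
- rewrite /p1 /cub /lin; solve_polypf.
move=> w /WP[wi Kij0 G0].
have hE := (horner_exp, hornerD, hornerN, hornerM, hornerX, hornerC).
have d0 : absc i w - absc j w != 0.
  by rewrite subr_eq0; apply: contraNneq ij => E; rewrite (wi _ _ E).
have s0 : side i k w != 0 by rewrite -sqrf_eq0 side_sqr ?oner_neq0.
split.
  (* At [absc i], [p1] takes the nonzero value [K i j * (absc i - absc j)^3 * side i k]. *)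
  apply/eqP => /(congr1 (horner^~ (absc i w))) /eqP; apply/negP.
  rewrite /p1 /cub /lin !hE ?horner0 subrr expr0n/= !(mulr0, mul0r) oppr0 !addr0.
  exact: mulf_neq0 (mulf_neq0 Kij0 (expf_neq0 3 d0)) s0.
transitivity (((absc k w - absc i w) * (absc k w - absc j w)) ^+ 2 * G i j k w);
  last by rewrite G0 mulr0.
rewrite /G /p0 /p1 /cub /lin /side !hE.
move: (K i j w) (K j i w) => c1 c2.
by rewrite /K ![cubeinv k _]cubeinv_sym /rhoa; ring.
Qed.

(** The two vanishing determinants make [absc k] and [absc l] algebraic over [absc i] and [absc j].
    The equations of [i] and [j] then give [mass j] and [mass i], dividing by [K i j] and
    [K j i]. *)
Lemma five_dimensional_pair i j k l : uniq [:: i; j; k; l] ->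
  five_dimensional [set w : T | [/\ reduced_solution w, K i j w != 0,
    K j i w != 0, G i j k w = 0 & G i j l w = 0]].
Proof.
move=> u; set W := [set w | _].
have WP w : W w -> injective w.2 by case=> -[].
pose zs0 : list (T -> R) := [:: mass k; mass l; @mass_off R; absc i; absc j].
have szs0 : stratified W zs0 5 := stratified_generators W zs0.
have aP0 : {in [:: i; j], forall x, polyf zs0 (absc x)}.
  by move=> x; rewrite !inE => /orP[] /eqP ->; apply: polyf_var => /=; tauto.
have uk : uniq [:: i; j; k] := uniq4_3 u.
have ul : uniq [:: i; j; l] := uniq4_3 (uniq4_rot (uniq4_rot (uniq4_swap
  (uniq4_rot (uniq4_rot u))))).
have [w [[]]//|x|zs1 [szs1 sub1 akP]] := extend_absc_pair uk _ szs0.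
  by move: x; exact: aP0.
have [w [[]]//|x xs|zs2 [szs2 sub2 alP]] := extend_absc_pair ul _ szs1.
  exact/sub1/aP0.
have mkP : polyf zs2 (mass k) by apply/sub2/sub1/polyf_var => /=; tauto.
have mlP : polyf zs2 (mass l) by apply/sub2/sub1/polyf_var => /=; tauto.
have moP : polyf zs2 (@mass_off R) by apply/sub2/sub1/polyf_var => /=; tauto.
have aP x : polyf zs2 (absc x).
  have := uniq4_mem x u; rewrite !inE => /or4P[]/eqP->.
  - by apply/sub2/sub1/aP0; rewrite inE eqxx.
  - by apply/sub2/sub1/aP0; rewrite !inE eqxx orbT.
  - exact: sub2.
  - exact: alP.
have [//|zs3 [szs3 sub3 bP0 kP0]] := K_extend (s := enum 'I_4) WP szs2.
have bP x : polyf zs3 (B x) by apply: bP0; rewrite mem_enum.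
have kP x y : x != y -> polyf zs3 (K x y).
  by move=> xy; case: (kP0 x y); rewrite ?mem_enum.
have row i' j' : uniq [:: i'; j'; k; l] ->
    (forall w, W w -> K i' j' w != 0) -> algebraic_over W zs3 (mass j').
  move=> u' K0; apply: (algebraic_quotient (f := K i' j') (h := fun w =>
    - (mass k w * K i' k w + mass l w * K i' l w + mass_off w * B i' w))).
  - by apply: kP; move: u'; rewrite /= !inE !negb_or => /andP[/and3P[]].
  - have [k1 k2] : polyf zs3 (K i' k) /\ polyf zs3 (K i' l).
      by split; apply: kP; move: u'; rewrite /= !inE !negb_or => /andP[/and3P[]].
    move: (sub3 _ mkP) (sub3 _ mlP) (sub3 _ moP) => ? ? ?; solve_polyf.
  - move=> w Ww; split; first exact: K0.
    case: Ww => -[_ /(_ _ _ _ _ u') E] _ _ _ _; apply/eqP.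
    by rewrite -addr_eq0 mulrC !addrA E.
have [x|zs4 [szs4 sub4 mP]] := stratified_extend szs3 (s := [:: i; j]) (g := @mass R).
  rewrite !inE => /orP[]/eqP->.
  - by apply: row (uniq4_swap u) _ => w [].
  - by apply: row u _ => w [].
exists zs4; split=> // [x||x]; [|exact/sub4/sub3|exact/sub4/sub3].
have := uniq4_mem x u; rewrite -[_ :: _]/([:: i; j] ++ [:: k; l]) mem_cat.
by case/orP=> [/mP//|]; rewrite !inE => /orP[]/eqP->; apply/sub4/sub3.
Qed.

(** Here [absc l] comes from the vanishing of [N], which leaves room for [mass_off] among the five
    generators. *)
Lemma five_dimensional_triple i j k l : uniq [:: i; j; k; l] ->
  five_dimensional [set w : T |
    [/\ reduced_solution w, G i j k w != 0 & N i j k l w = 0]].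
Proof.
move=> u; set W := [set w | _].
have WP w : W w -> injective w.2 by case=> -[].
pose zs0 : list (T -> R) := [:: mass l; @mass_off R; absc i; absc j; absc k].
have szs0 : stratified W zs0 5 := stratified_generators W zs0.
have aP0 x : x \in [:: i; j; k] -> polyf zs0 (absc x).
  by rewrite !inE => /or3P[] /eqP ->; apply: polyf_var => /=; tauto.
have [//|zs1 [szs1 sub1 alP]] := extend_absc_triple u _ szs0 aP0.
have aP x : polyf zs1 (absc x).
  have := uniq4_mem x u; rewrite -[_ :: _]/([:: i; j; k] ++ [:: l]) mem_cat.
  by rewrite mem_seq1 => /orP[/aP0/sub1//|/eqP->].
have [//|zs2 [szs2 sub2 bP kP]] := K_extend (s := enum 'I_4) WP szs1.
apply: (five_dimensional_cramer u _ szs2) => //.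
- by move=> w [].
- by move=> x; exact/sub2.
- by apply/sub2/sub1/polyf_var => /=; tauto.
- by apply/sub2/sub1/polyf_var => /=; tauto.
- by move=> x y xy; case: (kP x y); rewrite ?mem_enum.
- by move=> x; apply: bP; rewrite mem_enum.
Qed.
End Strata.

(** * Elimination *)

(** With [f] the constants and [phi] an evaluation, this computes specialisations of some variables
    of [Q]. *)
Lemma mmap_eval n (R S : comNzRingType) (f : R -> S) (phi : {rmorphism S -> R})
    (h : 'I_n -> S) (Q : {mpoly R[n]}) : cancel f phi ->
  phi (mmap f h Q) = Q.@[fun i => phi (h i)].
Proof.
move=> fK; rewrite mevalE rmorph_sum; apply: eq_bigr => m _.
rewrite rmorphM fK rmorph_prod; congr (_ * _).
by apply: eq_bigr => i _; rewrite rmorphXn.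
Qed.

Lemma finite_roots (F : fieldType) (p : {poly F}) : p != 0 ->
  exists s : seq F, forall x, root p x -> x \in s.
Proof.
have [n] := ubnP (size p); elim: n p => // n IH p sp p0.
have [[x /factor_theorem[q pE]]|noroot] := pselect (exists x, root p x); last first.
  by exists [::] => x px; case: noroot; exists x.
have q0 : q != 0 by apply: contraNneq p0 => q0; rewrite pE q0 mul0r.
have [|s sP] := IH q _ q0.
  by move: sp; rewrite pE size_mul ?polyXsubC_eq0// size_XsubC addn2/= ltnS.
exists (x :: s) => y; rewrite pE rootM root_XsubC inE orbC.
by move=> /orP[->//|/sP->]; rewrite orbT.
Qed.

Section GenericFiniteness.
Variable R : realType.
Let T := (('I_5 -> R) * ('I_4 -> R))%type.
Implicit Types (w : T) (i j k l : 'I_4) (W : set T).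

Definition extend (m : 'I_5 -> R) (x : R) : 'I_6 -> R :=
  fun o => oapp m x (unlift ord_max o).

Definition dependent W := exists Q : {mpoly R[6]}, Q != 0 /\
  forall w, W w -> forall i, Q.@[extend w.1 (w.2 i)] = 0.

Lemma dependent_bigcup (I : finType) (W : I -> set T) (V : set T) :
  (forall x, dependent (W x)) -> (forall w, V w -> exists x, W x w) -> dependent V.
Proof.
move=> /choice[Q QP] VW; exists (\prod_x Q x); split.
  by apply/prodf_neq0 => x _; case: (QP x).
move=> w /VW[x Wx] i; rewrite rmorph_prod/=.
by apply/eqP/prodf_eq0; exists x => //; case: (QP x) => _ ->.
Qed.

(** For each [i], the five masses and [absc i] are six functions on a set of dimension at most five;
    the product of the relations serves all [i]. *)
Lemma five_dimensional_dependent W : five_dimensional W -> dependent W.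
Proof.
move=> [zs [szs mP moP aP]].
have yP i : forall o, polyf zs (fun w => extend w.1 (w.2 i) o).
  move=> o; rewrite /extend; case: (unliftP ord_max o) => [j _|_] /=; last exact: aP.
  by case: (unliftP ord_max j) => [j' ->|->]; [exact: mP|exact: moP].
have /choice[Q QP] i := stratified_dependent szs (yP i).
exists (\prod_i Q i); split.
  by apply/prodf_neq0 => i _; case: (QP i).
move=> w Ww i; rewrite rmorph_prod/=.
by apply/eqP/prodf_eq0; exists i => //; case: (QP i) => _ ->.
Qed.

Lemma fresh_index (s : seq 'I_4) : (size s < 4)%N -> exists k, k \notin s.
Proof.
move=> s4; apply/existsP; apply: contraLR s4; rewrite negb_exists -leqNgt => /forallP sP.
rewrite -[X in (X <= _)%N](card_ord 4) (leq_trans _ (card_size s))//.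
by apply/subset_leq_card/fintype.subsetP => x _; have := sP x; rewrite negbK.
Qed.

(** Start from a regular pair [i], [j]. If [G i j k] and [G i j l] both vanish, [V3] applies;
    otherwise the vanishing of [N] decides between [V1] and [V2]. *)
Lemma reduced_solution_dependent : dependent (@reduced_solution R).
Proof.
pose V1 (x : 'I_4 * 'I_4 * 'I_4 * 'I_4) (w : T) := let: (i, j, k, l) := x in
  uniq [:: i; j; k; l] /\
  [/\ reduced_solution w, G i j k w != 0 & N i j k l w != 0].
pose V2 (x : 'I_4 * 'I_4 * 'I_4 * 'I_4) (w : T) := let: (i, j, k, l) := x in
  uniq [:: i; j; k; l] /\
  [/\ reduced_solution w, G i j k w != 0 & N i j k l w = 0].
pose V3 (x : 'I_4 * 'I_4 * 'I_4 * 'I_4) (w : T) := let: (i, j, k, l) := x in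
  uniq [:: i; j; k; l] /\
  [/\ reduced_solution w, K i j w != 0, K j i w != 0, G i j k w = 0 & G i j l w = 0].
pose V (x : 'I_3 * ('I_4 * 'I_4 * 'I_4 * 'I_4)) w :=
  if val x.1 == 0%N then V1 x.2 w else if val x.1 == 1%N then V2 x.2 w else V3 x.2 w.
(* Index tuples with repetitions give empty sets, for which [Q = 1] works. *)
have dep (P : bool) W : (P -> five_dimensional W) -> dependent (fun w => P /\ W w).
  case: P => [/(_ isT)/five_dimensional_dependent [Q [Q0 QP]]|_].
    by exists Q; split=> // w [_ /QP].
  by exists 1; split; [exact: oner_neq0|move=> w []].
apply: (@dependent_bigcup _ V) => [[c [[[i j] k] l]]|w sol].
  rewrite /V/=; case: eqP => _; last case: eqP => _; apply: dep => u.
  - exact: five_dimensional_generic.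
  - exact: five_dimensional_triple.
  - exact: five_dimensional_pair.
have triple i j k l : uniq [:: i; j; k; l] -> G i j k w != 0 -> exists x, V x w.
  move=> u G0; have [N0|N0] := eqVneq (N i j k l w) 0.
    by exists (lift ord0 ord0, (i, j, k, l)).
  by exists (ord0, (i, j, k, l)).
have [i [j [ij Kij Kji]]] := exists_regular_pair (proj1 sol).
have [//|k] := @fresh_index [:: i; j]; rewrite !inE negb_or => /andP[ki kj].
have [//|l] := @fresh_index [:: i; j; k]; rewrite !inE !negb_or => /and3P[li lj lk].
have u : uniq [:: i; j; k; l].
  by rewrite /= !inE !negb_or ij ![_ == k]eq_sym ![_ == l]eq_sym ki kj li lj lk.
have [G0|] := eqVneq (G i j k w) 0; last exact: triple u.
have [G1|] := eqVneq (G i j l w) 0; last first.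
  exact: triple (uniq4_rot (uniq4_rot (uniq4_swap (uniq4_rot (uniq4_rot u))))).
by exists (ord_max, (i, j, k, l)).
Qed.

Lemma generic_finiteness : exists F : {mpoly R[5]}, F != 0 /\
  forall m, F.@[m] != 0 -> finite_set [set a | reduced_solution (m, a)].
Proof.
have [Q [Q0 QP]] := reduced_solution_dependent.
(* With the last variable fixed at [tau], [Q] stays nonzero, as the other coordinates of [v]
   show. *)
have [v Qv] := mpoly_nonroot Q0; pose tau := v ord_max.
pose hF (o : 'I_6) : {mpoly R[5]} :=
  oapp (fun t => 'X_t) tau%:MP (unlift ord_max o).
have FE m : (mmap (@mpolyC 5 R) hF Q).@[m] = Q.@[extend m tau].
  rewrite mmap_eval => [|c]; last by rewrite /= mevalC.
  apply: meval_eq => o; rewrite /extend /hF; case: unliftP => [j _|_] /=.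
    exact: mevalXU.
  exact: mevalC.
exists (mmap (@mpolyC 5 R) hF Q); split=> [|m].
  have vE : v =1 extend (fun t => v (lift ord_max t)) tau.
    by move=> o; rewrite /extend; case: unliftP => [j ->|->].
  by apply: contraNneq Qv => F0; rewrite (meval_eq _ vE) -FE F0 meval0.
rewrite FE => Qm.
pose hU (o : 'I_6) : {poly R} := oapp (fun t => (m t)%:P) 'X (unlift ord_max o).
pose U : {poly R} := mmap (@polyC R) hU Q.
have UE x : U.[x] = Q.@[extend m x].
  rewrite -[LHS]/(horner_eval x U) mmap_eval => [|c]; last exact: hornerC.
  apply: meval_eq => o; rewrite /extend /hU.
  by case: unliftP => [j _|_] /=; rewrite /horner_eval ?hornerC ?hornerX.
(* [U] is [Q(m, X)]; it is nonzero because its value at [tau] is that of [F] at [m]. *)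
have [|s sP] := @finite_roots _ U.
  by apply: contraNneq Qm => U0; rewrite -UE U0 horner0.
have fin : finite_set [set: {ffun 'I_4 -> 'I_(size s)}] by exact: finite_finset.
pose nthf (f : {ffun 'I_4 -> 'I_(size s)}) i := s`_(f i).
apply: (sub_finite_set _ (finite_image nthf fin)) => a sol /=.
have aP i : a i \in s by apply: sP; rewrite rootE UE; apply/eqP/(QP _ sol).
exists [ffun i => Ordinal (etrans (index_mem _ _) (aP i))] => //.
by apply/funext => i; rewrite /nthf ffunE /= nth_index.
Qed.
End GenericFiniteness.

(** * Normal form of a cross configuration *)

Section NormalForm.
Variable R : realType.
Local Notation point := (Defs.point R).
Local Notation similar := (@Defs.similar R).
Implicit Types (u v p t : point) (y : point) (x z : config R) (a : 'I_4 -> R).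

Definition vec (c d : R) : point := \row_k (if k == 0 then c else d).

Lemma point_eq u v : u 0 0 = v 0 0 -> u 0 1 = v 0 1 -> u = v.
Proof.
move=> e0 e1; apply/rowP => k.
by case: (unliftP 0 k) => [j ->|->//]; rewrite (ord1 j) (_ : lift _ _ = 1)//;
  exact: val_inj.
Qed.

Lemma ord2P (i : 'I_2) : i = 0 \/ i = 1.
Proof.
case: (unliftP 0 i) => [j ->|->]; [right|by left].
by rewrite (ord1 j); apply: val_inj.
Qed.

Lemma det2E (A : 'M[R]_2) : \det A = A 0 0 * A 1 1 - A 0 1 * A 1 0.
Proof.
have l1 : lift ord0 ord0 = 1 :> 'I_2 by exact: val_inj.
rewrite (expand_det_row _ ord0) big_ord_recl big_ord1 /cofactor !det_mx11 !mxE l1.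
have -> : lift 1 0 = 0 :> 'I_2 by exact: val_inj.
rewrite /= expr0 expr1 mul1r.
by rewrite mulN1r mulrN.
Qed.

Lemma dotpE u v : dotp u v = u 0 0 * v 0 0 + u 0 1 * v 0 1.
Proof.
rewrite /dotp big_ord_recl big_ord1; congr (_ + u 0 _ * v 0 _); exact: val_inj.
Qed.

Lemma dotp_mx u v : dotp u v = (u *m v^T) 0 0.
Proof. by rewrite mxE; apply: eq_bigr => k _; rewrite mxE. Qed.

Lemma rotation_trK (A : 'M[R]_2) u : rotation A -> u *m A *m A^T = u.
Proof. by case=> AAT _; rewrite -mulmxA AAT mulmx1. Qed.

Lemma enorm_similar (k : R) A u : 0 < k -> rotation A ->
  enorm (k *: (u *m A)) = k * enorm u.
Proof.
move=> k0 rA; rewrite /enorm !dotp_mx linearZ /= trmx_mul -scalemxAl -scalemxAr.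
rewrite mulmxA (rotation_trK _ rA) scalerA !mxE -expr2 sqrtrM ?sqr_ge0//.
by rewrite sqrtr_sqr gtr0_norm.
Qed.

Lemma similar_sym x (y : config R) : similar x y -> similar y x.
Proof.
move=> [k [A [t [k0 rA yE]]]]; have [AAT dA] := rA.
exists k^-1, A^T, (- (k^-1 *: (t *m A^T))); split.
- by rewrite invr_gt0.
- by split; [rewrite trmxK; exact: mulmx1C|rewrite det_tr].
- move=> i; rewrite yE mulmxDl -scalemxAl (rotation_trK _ rA) scalerDr scalerA.
  by rewrite mulVf ?gt_eqF// scale1r addrK.
Qed.

Lemma similar_trans x (y : config R) z : similar x y -> similar y z -> similar x z.
Proof.
move=> [k [A [t [k0 [AAT dA] yE]]]] [k' [A' [t' [k'0 [AAT' dA'] zE]]]].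
exists (k' * k), (A *m A'), (k' *: (t *m A') + t'); split.
- exact: mulr_gt0.
- split; last by rewrite det_mulmx dA dA' mulr1.
  by rewrite trmx_mul mulmxA -[A *m A' *m _]mulmxA AAT' mulmx1.
- move=> i; rewrite zE yE mulmxDl -scalemxAl scalerDr scalerA -mulmxA.
  by rewrite addrA.
Qed.

Lemma similarity_class_eq x (y : config R) : similar x y ->
  similarity_class x = similarity_class y.
Proof.
move=> xy; apply/seteqP; split=> z /=; last exact: similar_trans.
exact/similar_trans/similar_sym.
Qed.

Lemma central_similar (m : 'I_6 -> R) x (y : config R) : similar x y ->
  central m y -> central m x.
Proof.
move=> [k [A [t [k0 rA yE]]]] [M0 inj [lam lam0 eqn]].
have yB i j : y j - y i = k *: ((x j - x i) *m A).
  by rewrite !yE opprD addrACA subrr addr0 -scalerBr -mulmxBl.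
have cE : mass_center m y = k *: (mass_center m x *m A) + t.
  rewrite /mass_center; under eq_bigr do rewrite yE scalerDr.
  rewrite big_split/= -scaler_suml -/(total_mass m) scalerDr scalerA mulVf// scale1r.
  congr (_ + _); rewrite -scalemxAl scalerA mulrC -scalerA; congr (_ *: _).
  rewrite mulmx_suml scaler_sumr; apply: eq_bigr => i _.
  by rewrite scalerA mulrC -scalerA -scalemxAl.
split=> //; first by move=> i j xij; apply: inj; rewrite !yE xij.
(* Attraction scales like [k^-2] and displacement from the centre like [k], whence the factor
   [k^3]. *)
exists (k ^+ 3 * lam); first by rewrite mulf_neq0// expf_neq0// gt_eqF.
move=> i; have := eqn i.
have -> : y i - mass_center m y = k *: ((x i - mass_center m x) *m A).
  by rewrite cE yE opprD addrACA subrr addr0 -scalerBr -mulmxBl.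
have dE j : dist y i j = k * dist x i j by rewrite /dist yB enorm_similar.
have k_neq0 : k != 0 by rewrite gt_eqF.
have tE j : (m j * dist y i j ^- 3) *: (y j - y i) =
    (k ^+ 3)^-1 *: (k *: (((m j * dist x i j ^- 3) *: (x j - x i)) *m A)).
  rewrite yB dE exprMn invfM -scalemxAl !scalerA; congr (_ *: _); ring.
rewrite (eq_bigr _ (fun j _ => tE j)) -!scaler_sumr -mulmx_suml.
set S := \sum_(j < 6 | j != i) _; set V := x i - _.
move=> /(congr1 (fun v => (k ^+ 3 * k^-1) *: (v *m A^T))).
rewrite mul0mx scaler0 => <-; rewrite mulmxDl -!scalemxAl !rotation_trK//.
rewrite [RHS]scalerDr !scalerA; congr (_ + _ *: _); last by field.
by rewrite -[LHS]scale1r; congr (_ *: _); field.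
Qed.

Definition on_axis (j : 'I_4) : 'I_6 := @lshift 4 2 j.
Definition off_axis (j : 'I_2) : 'I_6 := @rshift 4 2 j.

Definition normal_form a : config R := fun i : 'I_(4 + 2) =>
  match split i with
  | inl j => vec (a j) 0
  | inr j => vec 0 (if j == 0 then 1 else -1)
  end.

Lemma normal_form_axis a j : normal_form a (on_axis j) = vec (a j) 0.
Proof. by rewrite /normal_form (unsplitK (inl j)). Qed.

Lemma normal_form_off a j :
  normal_form a (off_axis j) = vec 0 (if j == 0 then 1 else -1).
Proof. by rewrite /normal_form (unsplitK (inr j)). Qed.

(** The added term [j = i] vanishes because of the factor [x i - x i], whatever the inverse of the
    zero distance is. *)
Lemma central_all (m : 'I_6 -> R) x : central m x ->
  exists lam, forall i, \sum_j (m j * dist x i j ^- 3) *: (x j - x i)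
         + lam *: (x i - mass_center m x) = 0.
Proof.
move=> [_ _ [lam _ eqn]]; exists lam => i.
by rewrite (bigD1 i)//= subrr scaler0 add0r.
Qed.

Lemma sum_uniq4 (f : 'I_4 -> R) i j k l : uniq [:: i; j; k; l] ->
  \sum_x f x = f i + f j + f k + f l.
Proof.
move=> u; transitivity (\sum_(x <- [:: i; j; k; l]) f x).
  by rewrite [RHS]big_uniq//=; apply: eq_bigl => t; rewrite (uniq4_mem t u).
by rewrite !big_cons big_nil addr0 !addrA.
Qed.

Lemma central_normal_form (m : 'I_5 -> R) a :
  central (masses6 m) (normal_form a) -> reduced_solution (m, a).
Proof.
move=> cen; have [_ inj _] := cen.
have [lam eqn] := central_all cen.
have mE j : masses6 m (on_axis j) = mass j (m, a).
  have E : minn (on_axis j) 4 = j by apply/minn_idPl/ltnW/(ltn_ord j).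
  rewrite /masses6 E /mass; congr (m _); apply: ord_inj.
  by rewrite inordK ?lift_max//; exact: leqW (ltn_ord j).
have moE j : masses6 m (off_axis j) = mass_off (m, a).
  have E : minn (off_axis j) 4 = 4%N by apply/minn_idPr/leq_addr.
  by rewrite /masses6 E /mass_off; congr (m _); apply: ord_inj; rewrite inordK.
have daa i j : dist (normal_form a) (on_axis i) (on_axis j) = `|a i - a j|.
  rewrite /dist /enorm dotpE !normal_form_axis !mxE /= subrr mulr0 addr0 -expr2.
  exact: sqrtr_sqr.
have sq j : (if j == 0 :> 'I_2 then 1 else -1 : R) ^+ 2 = 1.
  by case: ifP; rewrite ?sqrrN expr1n.
have dao i j : dist (normal_form a) (on_axis i) (off_axis j) = Num.sqrt (1 + a i ^+ 2).
  rewrite /dist /enorm dotpE normal_form_axis normal_form_off !mxE /=.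
  by rewrite subr0 sub0r mulrNN -!expr2 sq addrC.
have doa i j : dist (normal_form a) (off_axis j) (on_axis i) = Num.sqrt (1 + a i ^+ 2).
  rewrite /dist /enorm dotpE normal_form_axis normal_form_off !mxE /=.
  by rewrite subr0 sub0r mulrNN -!expr2 sq addrC.
have doo : dist (normal_form a) (off_axis 0) (off_axis 1) = 2.
  rewrite /dist /enorm dotpE !normal_form_off !mxE /= subrr mul0r add0r opprK.
  by rewrite -expr2 sqrtr_sqr -[1 + 1]/(2%:R) normr_nat.
(* The bodies off the axis have equal masses and opposite ordinates. *)
have c1 : mass_center (masses6 m) (normal_form a) 0 1 = 0.
  rewrite /mass_center mxE summxE (@big_split_ord _ _ _ 4 2)/= -/(on_axis _).
  rewrite big1 ?add0r => [|j _]; last first.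
    by rewrite normal_form_axis !mxE mulr0.
  rewrite big_ord_recl big_ord1 !normal_form_off !moE !mxE/=; ring.
set c0 := mass_center (masses6 m) (normal_form a) 0 0.
have comp (i : 'I_6) (c : 'I_2) :
    \sum_j mass j (m, a) * dist (normal_form a) i (on_axis j) ^- 3 *
       (vec (a j) 0 0 c - normal_form a i 0 c)
    + mass_off (m, a) * dist (normal_form a) i (off_axis 0) ^- 3 *
       (vec 0 1 0 c - normal_form a i 0 c)
    + mass_off (m, a) * dist (normal_form a) i (off_axis 1) ^- 3 *
       (vec 0 (-1) 0 c - normal_form a i 0 c)
    + lam * (normal_form a i 0 c
       - mass_center (masses6 m) (normal_form a) 0 c) = 0.
  have := eqn i; move: (mass_center _ _) => cm /(congr1 (fun v : point => v 0 c)).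
  rewrite (@big_split_ord _ _ _ 4 2)/= (@big_ord_recl _ _ _ 1) big_ord1.
  have -> : lift ord0 ord0 = 1 :> 'I_2 by exact: val_inj.
  rewrite -![rshift _ _]/(off_axis _) !mxE summxE => E; rewrite -[RHS]E addrA.
  congr (_ + _ + _ + _).
  - apply: eq_bigr => j _; rewrite -/(on_axis j) mE.
    by rewrite [in RHS]mxE [in RHS]mxE [in RHS]mxE normal_form_axis.
  - by rewrite moE normal_form_off !mxE.
  - by rewrite moE normal_form_off !mxE.
have v4 := comp (off_axis 0) 1; have h4 := comp (off_axis 0) 0.
split=> [i j|i j k l u].
  by move=> /= aij; have := inj (on_axis i) (on_axis j); rewrite !normal_form_axis aij
    => /(_ erefl)/(@lshift_inj 4 2).
have hi := comp (on_axis i) 0; move: v4 h4 hi.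
have e8 : (2 : R) ^+ 3 = 8 by rewrite -natrX.
rewrite !(sum_uniq4 _ u) !daa !doa !dao doo e8 c1 -/c0.
rewrite normal_form_axis normal_form_off !mxE/=.
move=> v4 h4 hi; set ev := (X in X = 0) in v4; set eh := (X in X = 0) in h4.
set ei := (X in X = 0) in hi.
(* [ei] is the horizontal equation of body [i]; [eh] and [ev] are the horizontal and vertical ones
   of the body at [(0, 1)]. In this combination [lam] and [c0] cancel. *)
transitivity (ei - eh - a i * ev); last by rewrite v4 h4 hi mulr0 !subr0.
rewrite /ei /eh /ev /K /B /cubeinv /rhoa /rho /absc /=.
ring.
Qed.

Lemma dotp_gt0 u : u != 0 -> 0 < dotp u u.
Proof.
move=> u0; rewrite lt_def dotpE -!expr2 addr_ge0 ?sqr_ge0// andbT.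
rewrite paddr_eq0 ?sqr_ge0// !sqrf_eq0; apply: contraNN u0 => /andP[/eqP e0 /eqP e1].
by apply/eqP/point_eq; rewrite mxE.
Qed.

Lemma dotpZl (c : R) u v : dotp (c *: u) v = c * dotp u v.
Proof. by rewrite !dotpE !mxE; ring. Qed.

Lemma dotpBl u v p : dotp (u - v) p = dotp u p - dotp v p.
Proof. by rewrite !dotpE !mxE; ring. Qed.

Lemma reflection_line p u y : u != 0 -> line p u y -> reflection p u y = y.
Proof.
move=> /dotp_gt0 q0 [s ->].
rewrite /reflection.
have -> : p + s *: u - p = s *: u by rewrite addrC addKr.
rewrite dotpZl mulrA mulfK ?gt_eqF// -addrA -scalerBl.
by congr (_ + _ *: _); ring.
Qed.

Lemma reflectionK p u : u != 0 -> involutive (reflection p u).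
Proof.
move=> /dotp_gt0 q0 y; rewrite /reflection; set d := y - p.
set c := 2 * dotp d u / dotp u u.
have -> : p + c *: u - d - p = c *: u - d by rewrite addrAC [p + _]addrC addrK.
rewrite dotpBl dotpZl.
have -> : 2 * (c * dotp u u - dotp d u) / dotp u u = c.
  by rewrite /c; field; rewrite gt_eqF.
by apply: point_eq; rewrite /d !mxE; ring.
Qed.

Lemma reflection_fixed p u y : reflection p u y = y -> line p u y.
Proof.
rewrite /reflection; set c := _ / _ => E; exists (c / 2); apply: point_eq.
  by move: (congr1 (fun v : point => v 0 0) E); rewrite !mxE => ?; lra.
by move: (congr1 (fun v : point => v 0 1) E); rewrite !mxE => ?; lra.
Qed.

(** The image of body 4 is a body. It is not on the axis, whose points are fixed by the involution,
    nor body 4 itself, since fixed points lie on the axis; body 5 remains. *)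
Lemma cross_mirror x p u : u != 0 -> reflection p u @` range x = range x ->
  (forall i : 'I_6, line p u (x i) <-> (i < 4)%N) ->
  reflection p u (x (off_axis 0)) = x (off_axis 1).
Proof.
move=> u0 sym axis.
have off j : ~ line p u (x (off_axis j)) by move/axis.
have [i _ xi] : range x (reflection p u (x (off_axis 0))).
  by rewrite -sym; exists (x (off_axis 0)) => //; exists (off_axis 0).
have : (exists j, i = on_axis j) \/ (exists j, i = off_axis j).
  by case: (@splitP 4 2 i) => j ij; [left|right]; exists j; apply: val_inj.
case=> [[j ij]|[j ij]]; subst i.
  case: (off 0); have : line p u (x (on_axis j)) by apply/axis/(ltn_ord j).
  move=> onj; have := reflection_line u0 onj; rewrite xi reflectionK// => ->.
  by rewrite -xi.
rewrite -xi; case: (unliftP 0 j) xi => [j' ->|-> /esym/reflection_fixed/off//] _.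
by congr (x (off_axis _)); rewrite (ord1 j'); exact: val_inj.
Qed.

(** The similarity sends the origin to the midpoint [t] of the two bodies off the axis and [(0, 1)]
    to [t + w], where [w] is half their difference. *)
Lemma cross_similar_normal_form x : injective x -> cross x ->
  exists a, similar (normal_form a) x.
Proof.
move=> inj [p [u [u0 sym axis]]].
have mirror := cross_mirror u0 sym axis.
have q_gt0 := dotp_gt0 u0.
pose al := dotp (x (off_axis 0) - p) u / dotp u u.
pose w : point := x (off_axis 0) - p - al *: u; pose t : point := p + al *: u.
have x4E : x (off_axis 0) = t + w by apply: point_eq; rewrite /t /w !mxE; ring.
have x5E : x (off_axis 1) = t - w.
  by rewrite -mirror /reflection /t /w -mulrA -/al; apply: point_eq; rewrite !mxE; ring.
have w_neq0 : w != 0.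
  apply/eqP => w0; have : x (off_axis 0) = x (off_axis 1).
    by rewrite x4E x5E w0 oppr0.
  by move=> /inj/(congr1 val).
have wu : w 0 0 * u 0 0 + w 0 1 * u 0 1 = 0.
  by rewrite -dotpE /w dotpBl dotpZl /al mulfVK ?subrr// gt_eqF.
have onax j : exists s, x (on_axis j) = p + s *: u by apply/axis/(ltn_ord j).
have [s sE] := choice onax.
have q0 := dotp_gt0 w_neq0; rewrite dotpE in q0.
set w1 := w 0 0 in wu q0; set w2 := w 0 1 in wu q0.
(* [u] is orthogonal to [w], hence [be] times the quarter turn [(w2, -w1)] of [w]. *)
pose be := (u 0 0 * w2 - u 0 1 * w1) / (w1 * w1 + w2 * w2).
have uE0 : u 0 0 = be * w2.
  have -> : be * w2 = w2 * (u 0 0 * w2 - u 0 1 * w1) / (w1 * w1 + w2 * w2).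
    by rewrite /be; ring.
  apply: (canRL (mulfK (negbT (gt_eqF q0)))).
  have -> : u 0 0 * (w1 * w1 + w2 * w2) =
    w1 * (w1 * u 0 0 + w2 * u 0 1) + w2 * (u 0 0 * w2 - u 0 1 * w1) by ring.
  by rewrite wu; ring.
have uE1 : u 0 1 = - (be * w1).
  have -> : - (be * w1) =
      - (w1 * (u 0 0 * w2 - u 0 1 * w1)) / (w1 * w1 + w2 * w2).
    by rewrite /be; ring.
  apply: (canRL (mulfK (negbT (gt_eqF q0)))).
  have -> : u 0 1 * (w1 * w1 + w2 * w2) =
    w2 * (w1 * u 0 0 + w2 * u 0 1) - w1 * (u 0 0 * w2 - u 0 1 * w1) by ring.
  by rewrite wu; ring.
pose k := Num.sqrt (w1 * w1 + w2 * w2).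
have k0 : 0 < k by rewrite sqrtr_gt0.
have kk : k * k = w1 * w1 + w2 * w2 by rewrite -expr2 sqr_sqrtr// ltW.
(* Points are row vectors: the rows [(w2, -w1) / k] and [(w1, w2) / k] are the images of the unit
   vectors. *)
pose A : 'M[R]_2 := \matrix_(i, j) (k^-1 *
  (if i == 0 then if j == 0 then w2 else - w1 else if j == 0 then w1 else w2)).
have AE c d : k *: (vec c d *m A) = vec (c * w2 + d * w1) (d * w2 - c * w1).
  apply: point_eq; rewrite !mxE big_ord_recl big_ord1 !mxE/=; field; rewrite ?gt_eqF//.
exists (fun j => (s j - al) * be), k, A, t; split=> //.
  have kV : k^-1 * k^-1 * (w1 * w1 + w2 * w2) = 1.
    by rewrite -kk; field; rewrite gt_eqF.
  split; last by rewrite det2E !mxE /= -[RHS]kV; ring.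
  apply/matrixP => i j; rewrite !mxE big_ord_recl big_ord1 !mxE/=.
  case: (ord2P i) (ord2P j) => -> [] -> /=; rewrite ?mulr1n ?mulr0n -?kV; ring.
move=> i; have : (exists j, i = on_axis j) \/ (exists j, i = off_axis j).
  by case: (@splitP 4 2 i) => j ij; [left|right]; exists j; apply: val_inj.
case=> -[j ->].
  rewrite normal_form_axis AE sE; apply: point_eq; rewrite !mxE /= ?uE0 ?uE1; ring.
rewrite normal_form_off AE; case: (ord2P j) => -> /=.
  by rewrite x4E; apply: point_eq; rewrite [in LHS]mxE [in RHS]mxE
    [vec _ _ _ _]mxE /= -/w1 -/w2; ring.
by rewrite x5E; apply: point_eq; rewrite [in LHS]mxE [in RHS]mxE [vec _ _ _ _]mxE
  [(- w) _ _]mxE /= -/w1 -/w2; ring.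
Qed.
End NormalForm.

(** * Finiteness of the similarity classes for generic masses *)

Theorem theorem1p1 (R : realType) :
  exists B : set ('I_5 -> R),
    [/\ zariski_closed B, B `<` setT &
        forall m : 'I_5 -> R, ~ B m ->
          finite_set [set similarity_class x | x in cross_central (masses6 m)]].
Proof.
have [F [F0 finF]] := generic_finiteness R.
have [v Fv] := mpoly_nonroot F0.
exists [set m | F.@[m] = 0]; split.
- exists [set F]; apply/seteqP; split=> m /=; first by move=> Fm _ ->.
  by apply.
- by split=> // /(_ v I)/= Fv0; rewrite Fv0 eqxx in Fv.
move=> m /= /eqP /finF fin.
(* Every class to be counted is that of a normal form whose abscissas range over a finite set. *)
pose class_of a := similarity_class (@normal_form R a).
apply: (sub_finite_set _ (finite_image class_of fin)).
move=> _ [x [cen _ crx] <-]; have [_ inj _] := cen.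
have [a sim] := cross_similar_normal_form inj crx.
exists a; last exact: similarity_class_eq.
exact/central_normal_form/(central_similar sim).
Qed.
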